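(* Let $m\in\{11,12,21,22,23,24\}$, let $p\ge 5$ be a prime and let $n\ge 1$ be an integer. Then the $p$-part $H_n(M_m,\mathbb{Z})_{(p)}$ of the integral homology of the Mathieu group $M_m$ is either trivial or isomorphic to $\mathbb{Z}_p$, and it is isomorphic to $\mathbb{Z}_p$ exactly in the following cases: \begin{itemize} \item $p=5$: $m\in\{11,12,22,23,24\}$ and $n=8k-1$ for some integer $k\ge 1$; or $m=21$ and $n=4k-1$ for some integer $k\ge 1$; \item $p=7$: $m\in\{21,22,23,24\}$ and $n=6k-1$ for some integer $k\ge 1$; \item $p=11$: $m\in\{11,12,22,23\}$ and $n=10k-1$ for some integer $k\ge 1$; or $m=24$ and $n=20k-1$ for some integer $k\ge 1$; \item $p=23$: $m\in\{23,24\}$ and $n=22k-1$ for some integer $k\ge 1$. \end{itemize} In all other cases (in particular for every prime $p\ge 5$ with $p\notin\{5,7,11,23\}$) one has $H_n(M_m,\mathbb{Z})_{(p)}=0$.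
   Context: $M_{11},M_{12},M_{22},M_{23},M_{24}$ are the sporadic simple Mathieu groups of the indicated degrees, and $M_{21}\cong PSL_3(4)$ is the point stabilizer in $M_{22}$. $H_n(G,\mathbb{Z})$ denotes the $n$-th integral group homology with trivial coefficients; for $G$ finite and $n\ge1$ it is a finite abelian group, and $H_n(G,\mathbb{Z})_{(p)}$ denotes its $p$-primary part (Sylow $p$-subgroup). $\mathbb{Z}_p$ denotes the cyclic group of order $p$. *)

(* Defs.v *)
From HB Require Import structures.
From mathcomp Require Import all_boot all_order all_fingroup all_algebra.
From mathcomp Require Import boolp.

Set Implicit Arguments.
Unset Strict Implicit.
Unset Printing Implicit Defensive.

Import GRing.Theory.
Local Open Scope ring_scope.

Section BarComplex.
Variable G : finGroupType.

(* The free abelian group on the bar symbols [g_1 | ... | g_n]; the entry g_k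
   sits at index k - 1. *)
Definition bar_chain (n : nat) := {ffun {ffun 'I_n -> G} -> int}.

HB.instance Definition _ n := GRing.Zmodule.on (bar_chain n).

Definition bar_symbol n (s : {ffun 'I_n -> G}) : bar_chain n :=
  [ffun t => (t == s)%:R].

(* The i-th face, 0 <= i <= n + 1, of [g_1 | ... | g_(n+1)]: drop g_1 if i = 0,
   replace g_i, g_(i+1) by g_i g_(i+1) if 0 < i < n + 1, and drop g_(n+1) if
   i = n + 1.  The values of lift ord_max j and lift ord0 j are j and j + 1. *)
Definition bar_face n (i : 'I_n.+2) (s : {ffun 'I_n.+1 -> G}) :
    {ffun 'I_n -> G} :=
  [ffun j : 'I_n =>
     if (j.+1 < i)%N then s (lift ord_max j)
     else if j.+1 == i :> nat then (s (lift ord_max j) * s (lift ord0 j))%g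
     else s (lift ord0 j)].

Definition bar_boundary n (c : bar_chain n.+1) : bar_chain n :=
  \sum_(s : {ffun 'I_n.+1 -> G})
    (\sum_(i < n.+2) bar_symbol (bar_face i s) *~ ((-1) ^+ i)) *~ c s.

Lemma bar_boundary_is_additive n : zmod_morphism (@bar_boundary n).
Proof.
move=> c d; rewrite /bar_boundary -sumrB; apply: eq_bigr => s _.
by rewrite !ffunE mulrzBr.
Qed.

HB.instance Definition _ n :=
  GRing.isZmodMorphism.Build (bar_chain n.+1) (bar_chain n) (@bar_boundary n)
    (@bar_boundary_is_additive n).

Definition bar_cycle (n : nat) : {pred bar_chain n} :=
  match n with
  | 0 => fun=> true
  | n'.+1 => fun c => bar_boundary c == 0
  end.

Lemma bar_cycle_closed n : zmod_closed (@bar_cycle n).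
Proof.
case: n => [|n]; split=> // [|c d]; rewrite !unfold_in /= ?raddf0 //.
by move=> /eqP c0 /eqP d0; rewrite raddfB /= c0 d0 subr0.
Qed.

HB.instance Definition _ n :=
  GRing.isZmodClosed.Build (bar_chain n) (@bar_cycle n) (@bar_cycle_closed n).

Record bar_cycles (n : nat) := BarCycle {
  cycle_val :> bar_chain n;
  _ : cycle_val \in @bar_cycle n }.

HB.instance Definition _ n := [isSub for @cycle_val n].
HB.instance Definition _ n := [Choice of bar_cycles n by <:].
HB.instance Definition _ n := [SubChoice_isSubZmodule of bar_cycles n by <:].

Definition bar_bound (n : nat) : {pred bar_cycles n} :=
  fun z => `[< exists c : bar_chain n.+1, bar_boundary c = val z >].

Lemma bar_bound_closed n : zmod_closed (@bar_bound n).
Proof.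
split=> [|y z]; rewrite !unfold_in; first by apply/asboolP; exists 0; rewrite !raddf0.
move=> /asboolP[c dc] /asboolP[d dd]; apply/asboolP; exists (c - d).
by rewrite !raddfB /= dc dd.
Qed.

HB.instance Definition _ n :=
  GRing.isZmodClosed.Build (bar_cycles n) (@bar_bound n) (@bar_bound_closed n).

(* H_n(G, Z), with trivial coefficients. *)
Definition homology (n : nat) : zmodType := Quotient.quot (@bar_bound n).

End BarComplex.

Section PrimaryPart.
Variables (p : nat) (A : zmodType).

Definition primary_pred : {pred A} := fun x => `[< exists k, x *+ (p ^ k) = 0 >].

Lemma primary_pred_closed : zmod_closed primary_pred.
Proof.
split=> [|x y]; rewrite !unfold_in; first by apply/asboolP; exists 0; rewrite mul0rn.
move=> /asboolP[k xk] /asboolP[l yl]; apply/asboolP; exists (k + l)%N.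
by rewrite mulrnBl expnD mulrnA xk mulnC mulrnA yl !mul0rn subr0.
Qed.

HB.instance Definition _ := GRing.isZmodClosed.Build A primary_pred primary_pred_closed.

Record primary_part := PrimaryPart {
  primary_val :> A;
  _ : primary_val \in primary_pred }.

HB.instance Definition _ := [isSub for primary_val].
HB.instance Definition _ := [Choice of primary_part by <:].
HB.instance Definition _ := [SubChoice_isSubZmodule of primary_part by <:].

End PrimaryPart.

Definition zmod_trivial (A : zmodType) : Prop := forall x : A, x = 0.

Definition zmod_iso (A B : zmodType) : Prop :=
  exists f : {additive A -> B}, bijective f.

Local Open Scope nat_scope.

(* The cycle (a_1 a_2 ... a_k) on {0, ..., N}, for s = [:: a_1; a_2; ...; a_k].
   Permutations compose from left to right. *)
Definition cyc (N : nat) (s : seq nat) : 'S_N.+1 :=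
  (\prod_(j <- behead s) tperm (inord (head 0 s)) (inord j))%g.

Definition cycs (N : nat) (ss : seq (seq nat)) : 'S_N.+1 :=
  (\prod_(s <- ss) cyc N s)%g.

(* M_12 on the projective line over F_11, 11 standing for infinity, generated by
   t |-> t + 1, t |-> -1/t and t |-> 4 t^2 - 3 t^7. *)
Definition M12_gens : {set 'S_12} :=
  [set cycs 11 [:: iota 0 11];
       cycs 11 [:: [:: 0; 11]; [:: 1; 10]; [:: 2; 5]; [:: 3; 7]; [:: 4; 8];
                   [:: 6; 9]];
       cycs 11 [:: [:: 2; 6; 10; 7]; [:: 3; 9; 4; 5]]].

Definition M12 : {group 'S_12} := <<M12_gens>>%G.

(* M_24 on the projective line over F_23, 23 standing for infinity, generated by
   t |-> t + 1, t |-> -1/t and the map fixing 0 and infinity and sending t to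
   t^3 / 9 if t is a nonzero square and to 9 t^3 if t is not a square. *)
Definition M24_gens : {set 'S_24} :=
  [set cycs 23 [:: iota 0 23];
       cycs 23 [:: [:: 0; 23]; [:: 1; 22]; [:: 2; 11]; [:: 3; 15]; [:: 4; 17];
                   [:: 5; 9]; [:: 6; 19]; [:: 7; 13]; [:: 8; 20];
                   [:: 10; 16]; [:: 12; 21]; [:: 14; 18]];
       cycs 23 [:: [:: 1; 18; 4; 2; 6]; [:: 5; 21; 20; 10; 7];
                   [:: 8; 16; 13; 9; 12]; [:: 11; 19; 22; 14; 17]]].

Definition M24 : {group 'S_24} := <<M24_gens>>%G.

(* M_m, of degree m, is the pointwise stabilizer in M_12 (if m <= 12) or in M_24
   (if m > 12) of the points m, m + 1, ...; so M_11 is a point stabilizer in M_12,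
   and M_23, M_22, M_21 are successive point stabilizers in M_24. *)
Definition Mathieu (m : nat) : finGroupType :=
  if m <= 12 then [subg 'C_(M12)([set i : 'I_12 | m <= i] | 'P)] : finGroupType
  else [subg 'C_(M24)([set i : 'I_24 | m <= i] | 'P)] : finGroupType.

Definition torsion_case (m p n : nat) : Prop :=
  [\/ p = 5 /\
        ((m \in [:: 11; 12; 22; 23; 24] /\
            exists k, 1 <= k /\ n = 8 * k - 1) \/
         (m = 21 /\ exists k, 1 <= k /\ n = 4 * k - 1)),
      p = 7 /\ m \in [:: 21; 22; 23; 24] /\
        (exists k, 1 <= k /\ n = 6 * k - 1),
      p = 11 /\
        ((m \in [:: 11; 12; 22; 23] /\
            exists k, 1 <= k /\ n = 10 * k - 1) \/
         (m = 24 /\ exists k, 1 <= k /\ n = 20 * k - 1))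
    | p = 23 /\ m \in [:: 23; 24] /\
        (exists k, 1 <= k /\ n = 22 * k - 1)].

(* Main.v *)
Require Import Defs.
From HB Require Import structures.
From mathcomp Require Import all_boot all_order all_fingroup all_algebra.
From mathcomp Require Import cyclic boolp zify.

(** For a prime p >= 5 a Sylow p-subgroup of a Mathieu group G is trivial or
    cyclic of order p, say P = <[x]>.  Then the p-part of H_n(G, Z) is the
    quotient of H_n(P, Z) by the action of the normalizer of P.  In positive
    even degree H_n(P, Z) vanishes; in degree 2 i - 1 it is cyclic of order p,
    and an automorphism x |-> x ^+ a of P acts on it as multiplication by
    a ^ i.  Hence, if the exponents a with x ^+ a conjugate to x form the
    subgroup of order d of the units modulo p, the p-part is Z_p when
    n = 2 d k - 1 and is trivial otherwise: this is homology_cyclic_sylow.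

    The homological half is a diagram chase in the homogeneous bar resolution,
    whose coinvariants are the given bar complex (proj).  Since P acts freely,
    x - 1 and the norm of P form an exact pair (delta0_norm, norm0_delta), so an
    alternating chase through this pair and the acyclicity of the resolution
    shows that every cycle of the P-coinvariants is, modulo boundaries, a
    multiple of one explicit chain (coinv_cycle_generated).  Multiplication by
    the index of P, which is prime to p, factors through the P-coinvariants by
    the transfer (bar_generate).  Comparing two resolutions of the same shape
    gives the action of x |-> x ^+ a (conj_pchain), hence the vanishing half.
    For the other half the generator is transferred back to P: translates by
    elements outside the normalizer cancel in double cosets, those inside
    contribute the index of P in its normalizer, and the chase run backwards
    detects this multiple modulo p (bar_pchain_nonbound).

    The group-theoretic half is a computation.  Permutations are written as
    tables of values, and M_12 and M_24 are given stabilizer chains whose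
    closure under the generators is checked on all products of a transversal
    element and a strong generator (complete, head_factor).  This yields the
    orders and identifies the point stabilizers with the members of the chain.
    For each group and prime a certificate consists of an element x of order p,
    of an element conjugating x to x ^+ a with a of order d modulo p, and of an
    exhaustive backtrack search through the chain (no_conj) showing that x is
    not conjugate to x ^+ b unless b ^ d = 1 modulo p. *)

Set Implicit Arguments.
Unset Strict Implicit.
Unset Printing Implicit Defensive.

Import GRing.Theory Num.Theory.

(** * Free abelian groups on finite types *)

Section Push.
Local Open Scope ring_scope.

Definition push (T U : finType) (f : T -> U) (c : {ffun T -> int}) :
    {ffun U -> int} :=
  [ffun u => \sum_(t | f t == u) c t].

Lemma push_is_additive (T U : finType) (f : T -> U) : zmod_morphism (push f).
Proof.
move=> c d; apply/ffunP=> u; rewrite !ffunE -sumrB.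
by apply: eq_bigr => t _; rewrite !ffunE.
Qed.

HB.instance Definition _ (T U : finType) (f : T -> U) :=
  GRing.isZmodMorphism.Build {ffun T -> int} {ffun U -> int} (push f)
    (@push_is_additive T U f).

Lemma push_comp (T U W : finType) (f : T -> U) (g : U -> W) c :
  push g (push f c) = push (g \o f) c.
Proof.
apply/ffunP=> w; rewrite !ffunE.
rewrite [RHS](partition_big f (fun u => g u == w)) //=.
apply: eq_bigr => u /eqP guw; rewrite ffunE; apply: eq_bigl => t.
by case: eqP => [->|]; rewrite ?andbF // guw eqxx.
Qed.

Lemma eq_push (T U : finType) (f g : T -> U) c :
  f =1 g -> push f c = push g c.
Proof.
by move=> fg; apply/ffunP=> u; rewrite !ffunE; apply: eq_bigl => t; rewrite fg.
Qed.

Lemma push_id (T : finType) (f : T -> T) c : f =1 id -> push f c = c.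
Proof.
move=> fid; apply/ffunP=> u; rewrite ffunE (eq_bigl (pred1 u)) ?big_pred1_eq //.
by move=> t; rewrite fid.
Qed.

Lemma push_can (T U : finType) (f : T -> U) (g : U -> T) c u :
  cancel f g -> cancel g f -> push f c u = c (g u).
Proof.
move=> fK gK; rewrite ffunE (eq_bigl (pred1 (g u))) ?big_pred1_eq // => t /=.
by rewrite -(can2_eq fK gK).
Qed.

End Push.

(** * The homogeneous bar resolution *)

Section Homogeneous.
Local Open Scope ring_scope.
Variable G : finGroupType.

Notation tup k := {ffun 'I_k -> G}.
Notation chain k := {ffun {ffun 'I_k -> G} -> int}.

Definition face k (i : 'I_k.+1) (s : tup k.+1) : tup k :=
  [ffun j => s (lift i j)].

(** Prepending a vertex; on chains this is a contraction of the augmented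
    complex in which the empty tuple spans degree 0. *)
Definition cone k (g : G) (s : tup k) : tup k.+1 :=
  [ffun j => if unlift ord0 j is Some j' then s j' else g].

Definition lmul k (g : G) (s : tup k) : tup k := [ffun j => (g * s j)%g].

(** The index k counts vertices, so that k = 0 is the augmentation module and
    the boundary from one vertex to none is the augmentation. *)
Definition bd k (c : chain k.+1) : chain k :=
  \sum_(i < k.+1) push (face i) c *~ ((-1) ^+ i).

Definition lact k (g : G) : chain k -> chain k := push (lmul g).

Lemma bd_is_additive k : zmod_morphism (@bd k).
Proof.
move=> c d; rewrite /bd -sumrB; apply: eq_bigr => i _.
by rewrite raddfB mulrzBl.
Qed.

HB.instance Definition _ k :=
  GRing.isZmodMorphism.Build (chain k.+1) (chain k) (@bd k) (@bd_is_additive k).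

HB.instance Definition _ k g := GRing.Additive.on (@lact k g).

Lemma face_cone0 k g (s : tup k) : face ord0 (cone g s) = s.
Proof. by apply/ffunP=> j; rewrite !ffunE liftK. Qed.

Lemma face_coneS k g (i : 'I_k.+1) (s : tup k.+1) :
  face (lift ord0 i) (cone g s) = cone g (face i s).
Proof.
apply/ffunP=> j; rewrite !ffunE; case: (unliftP ord0 j) => [j' ->|->].
  have ->: lift (lift ord0 i) (lift ord0 j') = lift ord0 (lift i j').
    by apply: val_inj; rewrite /= /bump /= !add1n ltnS addnS.
  by rewrite !liftK ffunE.
have ->: lift (lift ord0 i) ord0 = ord0 :> 'I_k.+2 by apply: val_inj.
by rewrite unlift_none.
Qed.

Lemma bd_cone k g (c : chain k.+1) :
  bd (push (cone g) c) = c - push (cone g) (bd c).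
Proof.
rewrite {1}/bd big_ord_recl /= expr0 mulr1z push_comp; congr (_ + _).
  by apply: push_id => s; apply: face_cone0.
rewrite /bd raddf_sum -sumrN; apply: eq_bigr => i _ /=.
rewrite exprS mulN1r mulrNz (raddfMz (push (cone g))) /= !push_comp.
congr (- (_ *~ _)).
by apply: eq_push => s; apply: face_coneS.
Qed.

Lemma bd_cone0 g (c : chain 0) : bd (push (cone g) c) = c.
Proof.
rewrite /bd big_ord1 /= expr0 mulr1z push_comp.
by apply: push_id => s; apply: face_cone0.
Qed.

Lemma acyclic k (y : chain k.+1) : bd y = 0 -> exists b, y = bd b.
Proof.
by move=> y0; exists (push (cone 1%g) y); rewrite bd_cone y0 raddf0 subr0.
Qed.

Lemma cone_surj k (u : tup k.+1) : u = cone (u ord0) (face ord0 u).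
Proof.
by apply/ffunP=> j; rewrite !ffunE; case: unliftP => [j' ->|-> //]; rewrite ffunE.
Qed.

Lemma cone_decomp k (c : chain k.+1) :
  c = \sum_g push (cone g) [ffun s => c (cone g s)].
Proof.
apply/ffunP=> u; rewrite sum_ffunE (bigD1 (u ord0)) //= big1 ?addr0.
  rewrite ffunE (big_pred1 (face ord0 u)).
    by rewrite ffunE -cone_surj.
  move=> s /=; apply/eqP/eqP => [<-|->]; first by rewrite face_cone0.
  by rewrite -cone_surj.
move=> g gu; rewrite ffunE big_pred0 // => s; apply/negP => /eqP su.
by move: gu; rewrite -su ffunE unlift_none eqxx.
Qed.

(** Proved from the cone formula by induction, which replaces the usual
    cancellation of pairs of faces. *)
Lemma bd_bd k (c : chain k.+2) : bd (bd c) = 0.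
Proof.
elim: k c => [|k IH] c; rewrite (cone_decomp c).
  rewrite (raddf_sum (@bd 1)) /=.
  rewrite (raddf_sum (@bd 0)) /= big1 // => g _.
  by rewrite bd_cone raddfB /= bd_cone0 subrr.
rewrite (raddf_sum (@bd k.+2)) /= (raddf_sum (@bd k.+1)) /= big1 // => g _.
by rewrite bd_cone raddfB /= bd_cone IH raddf0 subr0 subrr.
Qed.

Lemma bd_lact k g (c : chain k.+1) : bd (lact g c) = lact g (bd c).
Proof.
rewrite /bd raddf_sum; apply: eq_bigr => i _ /=.
rewrite raddfMz /= /lact !push_comp; congr (_ *~ _); apply: eq_push => s /=.
by apply/ffunP=> j; rewrite !ffunE.
Qed.

Lemma lactM k g h (c : chain k) : lact g (lact h c) = lact (g * h)%g c.
Proof.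
rewrite /lact push_comp; apply: eq_push => s /=.
by apply/ffunP=> j; rewrite !ffunE mulgA.
Qed.

Lemma lact1 k (c : chain k) : lact 1%g c = c.
Proof. by apply: push_id => s; apply/ffunP=> j; rewrite ffunE mul1g. Qed.

Lemma lmulK k g : cancel (@lmul k g) (lmul g^-1).
Proof. by move=> s; apply/ffunP=> j; rewrite !ffunE mulKg. Qed.

Lemma lmulKV k g : cancel (@lmul k g^-1) (lmul g).
Proof. by move=> s; apply/ffunP=> j; rewrite !ffunE mulKVg. Qed.

Lemma lactE k g (c : chain k) s : lact g c s = c (lmul g^-1 s).
Proof. by apply: push_can; [apply: lmulK | apply: lmulKV]. Qed.

Lemma lact0 g (c : chain 0) : lact g c = c.
Proof. by apply: push_id => s; apply/ffunP=> -[]. Qed.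

Definition norm k (A : {set G}) (c : chain k) : chain k :=
  \sum_(g in A) lact g c.

Lemma norm_is_additive k A : zmod_morphism (@norm k A).
Proof.
by move=> c d; rewrite /norm -sumrB; apply: eq_bigr => i _; rewrite raddfB.
Qed.

HB.instance Definition _ k A :=
  GRing.isZmodMorphism.Build (chain k) (chain k) (@norm k A)
    (@norm_is_additive k A).

Lemma bd_norm k A (c : chain k.+1) : bd (norm A c) = norm A (bd c).
Proof.
rewrite /norm (raddf_sum (@bd k)) /=.
by apply: eq_bigr => g _; rewrite bd_lact.
Qed.

Lemma normE k A (c : chain k) s :
  norm A c s = \sum_(g in A) c (lmul g^-1 s).
Proof. by rewrite sum_ffunE; apply: eq_bigr => g _; rewrite lactE. Qed.

(** The bar symbol of a simplex records the quotients of consecutive vertices,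
    which are invariant under left translation. *)
Definition bars k (s : tup k.+1) : tup k :=
  [ffun j => ((s (lift ord_max j))^-1 * s (lift ord0 j))%g].

Lemma bars_face k (i : 'I_k.+2) (s : tup k.+2) :
  bars (face i s) = bar_face i (bars s).
Proof.
apply/ffunP=> j; rewrite !ffunE.
have E (a b : 'I_k.+2) : val a = val b -> s a = s b by move=> /val_inj->.
have hj := ltn_ord j; have hi := ltn_ord i.
case: ltngtP => ji.
- congr (_^-1 * _)%g; apply: E; rewrite /= /bump /=; lia.
- congr (_^-1 * _)%g; apply: E; rewrite /= /bump /=; lia.
- have ->: s (lift ord_max (lift ord0 j)) = s (lift ord0 (lift ord_max j)).
    by apply: E; rewrite /= /bump /=; lia.
  rewrite -mulgA mulKVg; congr (_^-1 * _)%g; apply: E; rewrite /= /bump /=; lia.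
Qed.

Definition proj k (c : chain k.+1) : bar_chain G k := push (@bars k) c.

HB.instance Definition _ k :=
  GRing.isZmodMorphism.Build (chain k.+1) (bar_chain G k) (@proj k)
    (@push_is_additive _ _ (@bars k)).

Lemma bar_boundaryE k (c : bar_chain G k.+1) :
  bar_boundary c = \sum_(i < k.+2) push (bar_face i) c *~ ((-1) ^+ i).
Proof.
rewrite /bar_boundary; apply/ffunP=> t; rewrite !sum_ffunE.
under eq_bigr => s _ do rewrite mulrz_suml sum_ffunE.
rewrite exchange_big /=; apply: eq_bigr => i _.
rewrite ffunMzE ffunE mulrz_suml [RHS]big_mkcond /=; apply: eq_bigr => s _.
rewrite !ffunMzE ffunE eq_sym; case: eqP => _; last by rewrite !mul0rz.
by rewrite !mulrzz mulr1n mul1r mulrC.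
Qed.

Lemma proj_bd k (c : chain k.+2) : proj (bd c) = bar_boundary (proj c).
Proof.
rewrite bar_boundaryE /proj /bd raddf_sum; apply: eq_bigr => i _ /=.
rewrite (raddfMz (push (@bars k))) /= !push_comp; congr (_ *~ _).
apply: eq_push => s /=.
exact: bars_face.
Qed.

Lemma proj_lact k g (c : chain k.+1) : proj (lact g c) = proj c.
Proof.
rewrite /proj /lact push_comp; apply: eq_push => s /=; apply/ffunP=> j.
by rewrite !ffunE invMg -mulgA mulKg.
Qed.

(** The partial products of a bar symbol are the vertices of a lift. *)
Lemma proj_surj k (z : bar_chain G k) : exists c, proj c = z.
Proof.
pose f (s : tup k) (i : nat) : G := if insub i is Some i' then s i' else 1%g.
pose sec (s : tup k) : tup k.+1 := [ffun j : 'I_k.+1 => \prod_(i < j) f s i]%g.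
exists (push sec z); rewrite /proj push_comp; apply: push_id => s /=.
apply/ffunP=> j; rewrite !ffunE !lift_max /= /bump leq0n add1n.
by rewrite big_ord_recr /= mulKg /f valK.
Qed.

(** The fibres of bars are the orbits of left translation, on which G acts
    freely; so the norm of a chain at s is the value of its projection at the
    bar symbol of s. *)
Lemma norm_proj0 k (y : chain k.+1) : proj y = 0 -> norm setT y = 0.
Proof.
move=> y0; apply/ffunP=> s; rewrite normE [RHS]ffunE.
have := congr1 (fun c : {ffun _ -> int} => c (bars s)) y0.
rewrite !ffunE => e; rewrite -[RHS]e.
rewrite [RHS](reindex_onto (fun g => lmul g^-1 s)
           (fun s' : tup k.+1 => s ord0 * (s' ord0)^-1)%g) /=.
   apply: eq_bigl => g; rewrite inE; apply/esym/andP; split.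
    apply/eqP/ffunP=> j; rewrite !ffunE invMg -mulgA; by rewrite mulKg.
  by rewrite ffunE invMg invgK mulKVg.
move=> s' /eqP ss'; apply/ffunP=> j; rewrite ffunE invMg invgK.
have step (i : 'I_k) : ((s' (lift ord_max i))^-1 * s' (lift ord0 i) =
    (s (lift ord_max i))^-1 * s (lift ord0 i))%g.
  by have /ffunP/(_ i) := ss'; rewrite !ffunE.
have [m lem] : {m | j <= m}%N by exists j.
elim: m j lem => [|m IH] j jm.
  have ->: j = ord0 by apply: val_inj => /=; lia.
  by rewrite mulgKV.
case: (unliftP ord0 j) jm => [i ->|->] jm; last by rewrite mulgKV.
have im : (lift ord_max i <= m)%N by rewrite lift_max.
have := IH _ im.
rewrite -(mulKVg (s' (lift ord_max i)) (s' (lift ord0 i))) step => <-.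
by rewrite -[in LHS](mulKVg (s (lift ord_max i)) (s (lift ord0 i))) !mulgA.
Qed.

End Homogeneous.

Arguments norm {G k} A%_g c.

(** * Exactness of the action of a cyclic subgroup *)

Section Periodic.
Local Open Scope ring_scope.
Variable G : finGroupType.
Variable x : G.

Notation tup k := {ffun 'I_k -> G}.
Notation chain k := {ffun {ffun 'I_k -> G} -> int}.

Definition delta k (c : chain k) : chain k := lact x c - c.

Lemma delta_is_additive k : zmod_morphism (@delta k).
Proof.
move=> c d; rewrite /delta raddfB /= !opprB addrACA [RHS]addrACA.
by congr (_ + _); apply: addrC.
Qed.

HB.instance Definition _ k :=
  GRing.isZmodMorphism.Build (chain k) (chain k) (@delta k)
    (@delta_is_additive k).

(** The differentials of the periodic resolution of the cyclic group of x,
    as operators on any chain group. *)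
Definition pdiff n k (c : chain k) : chain k :=
  if odd n then norm <[x]> c else delta c.

Lemma pdiff_is_additive n k : zmod_morphism (@pdiff n k).
Proof. by move=> c d; rewrite /pdiff; case: ifP => _; rewrite raddfB. Qed.

HB.instance Definition _ n k :=
  GRing.isZmodMorphism.Build (chain k) (chain k) (@pdiff n k)
    (@pdiff_is_additive n k).

Lemma bd_delta k (c : chain k.+1) : bd (delta c) = delta (bd c).
Proof. by rewrite /delta raddfB /= bd_lact. Qed.

Lemma bd_pdiff n k (c : chain k.+1) : bd (pdiff n c) = pdiff n (bd c).
Proof. by rewrite /pdiff; case: ifP => _; rewrite (bd_norm, bd_delta). Qed.

Lemma norm_lact k h (c : chain k) : h \in <[x]>%g ->
  norm <[x]> (lact h c) = norm <[x]> c.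
Proof.
move=> hx; rewrite /norm [RHS](reindex_inj (mulIg h)) /=.
by apply: eq_big => [g|g _]; rewrite (groupMr, lactM).
Qed.

Lemma lact_norm k h (c : chain k) : h \in <[x]>%g ->
  lact h (norm <[x]> c) = norm <[x]> c.
Proof.
move=> hx; rewrite /norm (raddf_sum (@lact _ k h)) /=.
rewrite [RHS](reindex_inj (mulgI h)) /=.
by apply: eq_big => [g|g _]; rewrite (groupMl, lactM).
Qed.

Lemma norm_delta k (c : chain k) : norm <[x]> (delta c) = 0.
Proof. by rewrite /delta raddfB /= norm_lact ?cycle_id // subrr. Qed.

Lemma delta_norm k (c : chain k) : delta (norm <[x]> c) = 0.
Proof. by rewrite /delta lact_norm ?cycle_id // subrr. Qed.

Lemma pdiffK n k (c : chain k) : pdiff n.+1 (pdiff n c) = 0.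
Proof.
by rewrite /pdiff /=; case: (odd n); rewrite (norm_delta, delta_norm).
Qed.

Definition rep g := repr (<[x]> :* g)%g.
(** Representatives of the right cosets of <[x]>: the sum of the translates by
    them is the transfer to <[x]>. *)
Definition reps : {set G} := [set g | rep g == g].

Lemma repP g : exists2 h, h \in <[x]>%g & g = (h * rep g)%g.
Proof.
have /rcosetP[h hx e] : rep g \in (<[x]> :* g)%g by apply: mem_repr_rcoset.
by exists h^-1%g; rewrite ?groupV // e mulKg.
Qed.

Lemma repM h g : h \in <[x]>%g -> rep (h * g)%g = rep g.
Proof. by move=> hx; rewrite /rep rcosetM rcoset_id. Qed.

Lemma rep_in_reps g : rep g \in reps.
Proof.
by rewrite inE; case: (repP g) => h hx e; rewrite {2}e repM.
Qed.

Lemma rep_eq g h : (rep g == rep h) = (g * h^-1 \in <[x]>)%g.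
Proof.
apply/eqP/idP => [e|gh]; last by rewrite -[in LHS](mulgKV h g) repM.
case: (repP g) => a ax ->; case: (repP h) => b bx ->.
by rewrite e invMg mulgA mulgK groupM ?groupV.
Qed.

Lemma rep_id t : t \in reps -> rep t = t.
Proof. by rewrite inE => /eqP. Qed.

Lemma sum_reps (V : nmodType) (A : {set G}) (F : G -> V) :
  (forall h g, h \in <[x]>%g -> (h * g \in A)%g = (g \in A)) ->
  \sum_(g in A) F g = \sum_(t in reps :&: A) \sum_(h in <[x]>%g) F (h * t)%g.
Proof.
move=> xA; have repA g : (rep g \in A) = (g \in A).
  by case: (repP g) => h hx e; rewrite {2}e xA.
rewrite (partition_big rep (fun t => t \in reps :&: A)) => [|g gA]; last first.
  by rewrite inE rep_in_reps repA.
apply: eq_bigr => t; rewrite inE => /andP[tT tA].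
rewrite (reindex_inj (mulIg t)) /=; apply: eq_bigl => h.
have -> : (rep (h * t)%g == t) = (h \in <[x]>%g).
  by rewrite -{2}(rep_id tT) rep_eq mulgK.
rewrite andbC.
by case hx: (h \in _) => //=; rewrite xA.
Qed.

(** Norm of <[x]> after transfer is the norm of the whole group. *)
Lemma norm_reps k (c : chain k) : norm <[x]> (norm reps c) = norm setT c.
Proof.
rewrite [RHS]/norm sum_reps ?setIT // => [|h g _]; last by rewrite !inE.
rewrite /norm exchange_big /=; apply: eq_bigr => h hx.
rewrite (raddf_sum (@lact _ k h)) /=.
by apply: eq_bigr => t _; rewrite lactM.
Qed.

Lemma card_reps (A : {set G}) :
  (forall h g, h \in <[x]>%g -> (h * g \in A)%g = (g \in A)) ->
  #|A| = (#|reps :&: A| * #[x]%g)%N.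
Proof.
move=> xA; rewrite -sum1_card (sum_reps _ xA) -sum_nat_const.
by apply: eq_bigr => t _; rewrite sum1_card.
Qed.

(** The part of a chain supported on the simplices whose first vertex lies at
    h times the representative of its coset. *)
Definition fibre_part k (h : G) (y : chain k.+1) : chain k.+1 :=
  [ffun s : tup k.+1 => if (s ord0 * (rep (s ord0))^-1 == h)%g then y s else 0].

(** An invariant chain is the norm of its restriction to a fundamental domain,
    the simplices whose first vertex is a coset representative. *)
Lemma delta0_norm k (y : chain k.+1) :
  delta y = 0 -> exists y', y = norm <[x]> y'.
Proof.
move=> /eqP; rewrite subr_eq0 => /eqP yx.
have yh h : h \in <[x]>%g -> lact h y = y.
  move=> /cycleP[i ->]; elim: i => [|i IH]; first by rewrite expg0 lact1.
  by rewrite expgS -lactM IH.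
exists (fibre_part 1%g y); apply/ffunP=> s; rewrite normE.
case: (repP (s ord0)) => h hx sh; rewrite (bigD1 h) //= big1 ?addr0.
  rewrite !ffunE {1 2}sh mulKg (rep_id (rep_in_reps _)) mulgV eqxx.
  by rewrite -[in LHS](yh h) // lactE.
move=> g /andP[gx gh]; rewrite !ffunE; case: eqP => // e; case/eqP: gh.
move: e; rewrite repM ?groupV // {1}sh -mulgA mulgK => /eqP.
by rewrite -eq_mulVg1 => /eqP.
Qed.

Lemma lact_delta k h (c : chain k) : h \in <[x]>%g ->
  exists b, lact h c = c + delta b.
Proof.
move=> /cycleP[i ->]; elim: i => [|i [b IH]].
  by exists 0; rewrite expg0 lact1 raddf0 addr0.
exists (lact (x ^+ i)%g c + b); rewrite expgS -lactM raddfD /= addrCA -IH.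
by rewrite /delta subrK.
Qed.

(** Modulo the image of delta each fibre part can be translated by h^-1 into
    the fundamental domain, where the sum of the translates is the restriction
    of the norm of y. *)
Lemma norm0_delta k (y : chain k.+1) :
  norm <[x]> y = 0 -> exists y', y = delta y'.
Proof.
move=> Ny0.
have y_parts : y = \sum_(h in <[x]>%g) fibre_part h y.
  apply/ffunP=> s; rewrite sum_ffunE; case: (repP (s ord0)) => h hx sh.
  rewrite (bigD1 h) //= big1 ?addr0; first by rewrite ffunE {1}sh mulgK eqxx.
  by move=> g /andP[_ gh]; rewrite ffunE {1}sh mulgK eq_sym (negbTE gh).
have rest : \sum_(h in <[x]>%g) lact h^-1%g (fibre_part h y) = 0.
  apply/ffunP=> s; rewrite sum_ffunE [RHS]ffunE.
  have [sT|sT] := boolP (rep (s ord0) == s ord0).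
    have := congr1 (fun c : {ffun _ -> int} => c s) Ny0.
    rewrite normE [in X in _ = X]ffunE => e; rewrite -[RHS]e.
    rewrite [LHS](reindex_inj invg_inj) /=.
    apply: eq_big => [h|h hx]; rewrite ?groupV // lactE !ffunE invgK.
    by rewrite repM // (eqP sT) mulgK eqxx.
  rewrite big1 // => h hx; rewrite lactE !ffunE invgK repM //.
  case: eqP => // /eqP; rewrite -mulgA -[X in _ == X]mulg1.
  rewrite (inj_eq (mulgI _)) -eq_mulgV1 => /eqP e.
  by rewrite -e eqxx in sT.
have : exists y', \sum_(h in <[x]>%g)
    (fibre_part h y - lact h^-1%g (fibre_part h y)) = delta y'.
  elim/big_ind: _ => [|_ _ [a ->] [b ->]|h hx].
  - by exists 0; rewrite raddf0.
  - by exists (a + b); rewrite raddfD.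
  have [b e] := lact_delta (lact h^-1%g (fibre_part h y)) hx.
  by exists b; rewrite lactM mulgV lact1 in e; rewrite {1}e addrC addKr.
by case=> y'; rewrite sumrB -y_parts rest subr0; exists y'.
Qed.

End Periodic.

(** * Chains generating the homology of a cyclic subgroup *)

Section Resolution.
Local Open Scope ring_scope.
Variable G : finGroupType.
Implicit Types x g h : G.

Notation tup k := {ffun 'I_k -> G}.
Notation chain k := {ffun {ffun 'I_k -> G} -> int}.

Lemma bdD k (a b : chain k.+1) : bd (a + b) = bd a + bd b.
Proof. exact: raddfD. Qed.
Lemma bdMn k (a : chain k.+1) m : bd (a *+ m) = bd a *+ m.
Proof. exact: raddfMn. Qed.
Lemma bdMz k (a : chain k.+1) m : bd (a *~ m) = bd a *~ m.
Proof. exact: raddfMz. Qed.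
Lemma deltaD x k (a b : chain k) : delta x (a + b) = delta x a + delta x b.
Proof. exact: raddfD. Qed.
Lemma deltaB x k (a b : chain k) : delta x (a - b) = delta x a - delta x b.
Proof. exact: raddfB. Qed.
Lemma deltaMn x k (a : chain k) m : delta x (a *+ m) = delta x a *+ m.
Proof. exact: raddfMn. Qed.
Lemma deltaMz x k (a : chain k) m : delta x (a *~ m) = delta x a *~ m.
Proof. exact: raddfMz. Qed.
Lemma normD A k (a b : chain k) : norm A (a + b) = norm A a + norm A b.
Proof. exact: raddfD. Qed.
Lemma normB A k (a b : chain k) : norm A (a - b) = norm A a - norm A b.
Proof. exact: raddfB. Qed.
Lemma normMn A k (a : chain k) m : norm A (a *+ m) = norm A a *+ m.
Proof. exact: raddfMn. Qed.
Lemma normMz A k (a : chain k) m : norm A (a *~ m) = norm A a *~ m.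
Proof. exact: raddfMz. Qed.
Lemma projD k (a b : chain k.+1) : proj (a + b) = proj a + proj b.
Proof. exact: raddfD. Qed.
Lemma projB k (a b : chain k.+1) : proj (a - b) = proj a - proj b.
Proof. exact: raddfB. Qed.
Lemma projMn k (a : chain k.+1) m : proj (a *+ m) = proj a *+ m.
Proof. exact: raddfMn. Qed.
Lemma projMz k (a : chain k.+1) m : proj (a *~ m) = proj a *~ m.
Proof. exact: raddfMz. Qed.

Lemma proj_delta x k (a : chain k.+1) : proj (delta x a) = 0.
Proof. by rewrite /delta projB proj_lact subrr. Qed.

Definition aug1 : chain 0 := [ffun => 1].

Lemma chain0E (c : chain 0) : exists k, c = aug1 *~ k.
Proof.
exists (c [ffun=> 1%g]); apply/ffunP=> s; rewrite ffunMzE ffunE mulrzz mul1r.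
by congr (c _); apply/ffunP=> -[].
Qed.

Lemma norm0 x (c : chain 0) : norm <[x]> c = c *+ #[x]%g.
Proof.
by rewrite /norm (eq_bigr (fun=> c)) => [|g _]; rewrite ?sumr_const ?lact0.
Qed.

Lemma delta0 x (c : chain 0) : delta x c = 0.
Proof. by rewrite /delta lact0 subrr. Qed.

(** The data of a chain map, over the augmentation, from the periodic resolution
    of <[x]> to the bar resolution, given by the images of the generators. *)
Definition res_seq x (W : forall n, chain n.+1) : Prop :=
  bd (W 0) = aug1 /\ forall n, bd (W n.+1) = pdiff x n (W n).

(** The sequence obtained from the contraction with apex 1; its terms of odd
    degree will generate the homology of <[x]>. *)
Fixpoint pchain x n : chain n.+1 :=
  match n with
  | 0 => push (cone 1%g) aug1
  | n'.+1 => push (cone 1%g) (pdiff x n' (pchain x n'))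
  end.

Lemma pchain_res x : res_seq x (pchain x).
Proof.
split=> [|n]; first exact: bd_cone0.
suff cycle_n : bd (pdiff x n (pchain x n)) = 0.
  by rewrite /= bd_cone cycle_n raddf0 subr0.
elim: n => [|n IH]; rewrite bd_pdiff.
  by rewrite /pdiff /= delta0.
by rewrite /= bd_cone IH raddf0 subr0 pdiffK.
Qed.

Lemma bd_pchain0 x : bd (pchain x 0) = aug1.
Proof. by case: (pchain_res x). Qed.

Lemma bd_pchain x n : bd (pchain x n.+1) = pdiff x n (pchain x n).
Proof. by case: (pchain_res x). Qed.

Lemma eq_bd k (y z : chain k.+1) : bd y = bd z -> exists b, y = z + bd b.
Proof.
move=> yz; have [b e] : exists b, y - z = bd b.
  by apply: acyclic; rewrite raddfB /= yz subrr.
by exists b; rewrite -e addrC subrK.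
Qed.

(** If the norm of bd z vanishes then bd z = delta w for some w; as
    delta (bd w) = 0, bd w = norm y, and y satisfies the hypothesis two degrees
    lower.  The multiple of pchain found for y is transported back through
    bd (pchain x n.+1) = pdiff x n (pchain x n).  In even degree it is killed
    because augmentation turns norm into multiplication by #[x], which is
    injective on integers. *)
Lemma coinv_cycle_generated x n (z : chain n.+2) : norm <[x]> (bd z) = 0 ->
  exists k b b', z = pchain x n.+1 *~ k + bd b + delta x b' /\ (odd n -> k = 0).
Proof.
pose P n := forall z : chain n.+2, norm <[x]> (bd z) = 0 ->
  exists k b b', z = pchain x n.+1 *~ k + bd b + delta x b' /\ (odd n -> k = 0).
(* the ascending half of each step of the chase *)
have lift_delta n0 (z0 : chain n0.+2) k b : (odd n0 -> k = 0) ->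
    bd z0 = delta x (pchain x n0 *~ k + bd b) ->
    exists k b b',
      z0 = pchain x n0.+1 *~ k + bd b + delta x b' /\ (odd n0 -> k = 0).
  move=> k0 e; have /eq_bd[c ->] : bd z0 = bd (pchain x n0.+1 *~ k + delta x b).
    rewrite e bdD deltaD bd_delta bdMz deltaMz bd_pchain.
    by rewrite /pdiff; case: (odd n0) k0 => [->|_]; rewrite ?mulr0z.
  by exists k, c, b; split; rewrite // addrAC.
suff [] : P n /\ P n.+1 by move=> Pn _; apply: Pn.
elim: n {z} => [|n [IH IH']]; split=> // z.
- move=> /norm0_delta[w e]; have [k ek] := chain0E (bd w).
  have /eq_bd[b eb] : bd w = bd (pchain x 0 *~ k).
    by rewrite bdMz bd_cone0.
  by apply: (lift_delta _ z k b); rewrite -?eb.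
- move=> /norm0_delta[w e].
  have : delta x (bd w) = 0 by rewrite -bd_delta -e bd_bd.
  move=> /delta0_norm[y ey]; have : bd y = 0.
    have : norm <[x]> (bd y) = 0 by rewrite -bd_norm -ey bd_bd.
    rewrite norm0; have [k ->] := chain0E (bd y) => /ffunP/(_ [ffun=> 1%g]).
    rewrite ffunMnE ffunMzE !ffunE mulrzz mul1r => /eqP.
    by rewrite mulrn_eq0 eqn0Ngt order_gt0 /= => /eqP ->; rewrite mulr0z.
  move=> /acyclic[b eb]; have /eq_bd[b' ew] : bd w = bd (norm <[x]> b).
    by rewrite bd_norm -eb.
  apply: (lift_delta _ z 0 b') => //.
  by rewrite e ew mulr0z add0r deltaD delta_norm add0r.
move=> /norm0_delta[w e].
have : delta x (bd w) = 0 by rewrite -bd_delta -e bd_bd.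
move=> /delta0_norm[y ey].
have /IH[k [b [b' [ey' k0]]]] : norm <[x]> (bd y) = 0.
  by rewrite -bd_norm -ey bd_bd.
have /eq_bd[c ew] : bd w = bd (pchain x n.+2 *~ k + norm <[x]> b).
  rewrite ey ey' 2!normD norm_delta addr0 bdD bd_norm bdMz normMz bd_pchain /pdiff /=.
  by case: (odd n) k0 => [->|_]; rewrite ?mulr0z.
apply: (lift_delta _ z k c); first by rewrite /= negbK.
by rewrite e ew 3!deltaD delta_norm addr0.
Qed.

(** The chains whose class in the coinvariants under <[x]> is a boundary. *)
Definition coinv_null x k (y : chain k.+1) : Prop :=
  exists b b', y = delta x b + bd b'.

Lemma coinv_null0 x k : coinv_null x (0 : chain k.+1).
Proof. by exists 0, 0; rewrite !raddf0 addr0. Qed.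

Lemma coinv_nullD x k (y z : chain k.+1) :
  coinv_null x y -> coinv_null x z -> coinv_null x (y + z).
Proof.
move=> [a [b ->]] [c [d ->]]; exists (a + c), (b + d).
by rewrite !raddfD /= addrACA.
Qed.

Lemma coinv_nullN x k (y : chain k.+1) : coinv_null x y -> coinv_null x (- y).
Proof. by move=> [a [b ->]]; exists (- a), (- b); rewrite !raddfN opprD. Qed.

Lemma coinv_null_trans x k (z y w : chain k.+1) :
  coinv_null x (y - z) -> coinv_null x (z - w) -> coinv_null x (y - w).
Proof. by move=> yz /(coinv_nullD yz); rewrite addrA subrK. Qed.

Lemma coinv_null_bd x k (y : chain k.+2) : coinv_null x (bd y).
Proof. by exists 0, y; rewrite raddf0 add0r. Qed.

Lemma coinv_null_sum x k (I : finType) (A : pred I) (F : I -> chain k.+1) :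
  (forall i, A i -> coinv_null x (F i)) -> coinv_null x (\sum_(i | A i) F i).
Proof.
by move=> AS; elim/big_ind: _ => //; [apply: coinv_null0 | apply: coinv_nullD].
Qed.

Lemma coinv_nullMn x k (y : chain k.+1) m :
  coinv_null x y -> coinv_null x (y *+ m).
Proof.
move=> yS; elim: m => [|m IH]; first exact: coinv_null0.
by rewrite mulrS; apply: coinv_nullD.
Qed.

Lemma coinv_null_lact x k h (y : chain k.+1) :
  h \in <[x]>%g -> coinv_null x (lact h y - y).
Proof.
move=> hx; have [b ->] := lact_delta y hx.
by exists b, 0; rewrite raddf0 addr0 addrC addKr.
Qed.

Lemma coinv_null_proj x k (y : chain k.+1) :
  coinv_null x y -> exists c, proj y = bar_boundary c.
Proof.
move=> [b [b' ->]]; exists (proj b').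
by rewrite projD proj_delta add0r proj_bd.
Qed.

(** The usual construction of a chain homotopy, carried out on generators. *)
Lemma res_unique x W W' : res_seq x W -> res_seq x W' ->
  forall n, exists b b', W n.+1 - W' n.+1 = pdiff x n b + bd b'.
Proof.
move=> [W0 Wn] [W0' Wn'].
have step n b : pdiff x n (W n - W' n) = pdiff x n (bd b) ->
    exists b', W n.+1 - W' n.+1 = pdiff x n b + bd b'.
  move=> e; apply: eq_bd; rewrite raddfB /= Wn Wn' bd_pdiff -e.
  by rewrite raddfB.
suff Q n : exists b, pdiff x n (W n - W' n) = pdiff x n (bd b).
  by move=> n; case: (Q n) => b /step[b' e]; exists b, b'.
elim: n => [|n [b /step[b' ->]]]; last by exists b'; rewrite raddfD /= pdiffK add0r.
have [b ->] : exists b, W 0 - W' 0 = bd b.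
  by apply: acyclic; rewrite raddfB /= W0 W0' subrr.
by exists b.
Qed.

(** Left translation by g intertwines the differentials for x and for
    its conjugate g x g^-1. *)
Lemma lact_pdiff x g n k (c : chain k) :
  lact g (pdiff x n c) = pdiff (x ^ g^-1)%g n (lact g c).
Proof.
rewrite /pdiff; case: (odd n); last first.
  by rewrite /delta raddfB /= !lactM conjgE invgK -!mulgA mulVg mulg1.
rewrite /norm (raddf_sum (@lact _ k g)) /= cycleJ.
rewrite [RHS](reindex_inj (@conjg_inj _ (g^-1)%g)) /=.
apply: eq_big => [h|h _]; first by rewrite memJ_conjg.
by rewrite !lactM conjgE invgK -!mulgA mulVg mulg1.
Qed.

Lemma lact_res x g W : res_seq x W ->
  res_seq (x ^ g^-1)%g (fun n => lact g (W n)).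
Proof.
move=> [W0 Wn]; split=> [|n]; first by rewrite bd_lact W0 lact0.
by rewrite bd_lact Wn lact_pdiff.
Qed.

(** The operator 1 + x + ... + x^(a-1), by which x - 1 has to be multiplied to
    give x^a - 1. *)
Definition geo x a k (c : chain k) : chain k := \sum_(j < a) lact (x ^+ j)%g c.

Lemma geo_is_additive x a k : zmod_morphism (@geo x a k).
Proof.
by move=> c d; rewrite /geo -sumrB; apply: eq_bigr => i _; rewrite raddfB.
Qed.

HB.instance Definition _ x a k :=
  GRing.isZmodMorphism.Build (chain k) (chain k) (@geo x a k)
    (@geo_is_additive x a k).

Lemma delta_geo x a k (c : chain k) : delta x (geo x a c) = delta (x ^+ a)%g c.
Proof.
rewrite /delta {1}/geo (raddf_sum (@lact _ k x)) /= /geo -sumrB.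
under eq_bigr => i _ do rewrite lactM -expgS.
rewrite -(big_mkord xpredT (fun j => lact (x ^+ j.+1)%g c - lact (x ^+ j)%g c)).
by rewrite (telescope_sumr (fun j => lact (x ^+ j)%g c)) // expg0 lact1.
Qed.

Lemma bd_geo x a k (c : chain k.+1) : bd (geo x a c) = geo x a (bd c).
Proof.
rewrite /geo (raddf_sum (@bd _ k)) /=.
by apply: eq_bigr => i _; rewrite bd_lact.
Qed.

Lemma geo_pdiff x a n k (c : chain k) :
  geo x a (pdiff x n c) = pdiff x n (geo x a c).
Proof.
rewrite /geo (raddf_sum (@pdiff _ x n k)) /=; apply: eq_bigr => j _.
by rewrite lact_pdiff conjgE invgK mulgA -expgSr expgS mulgK.
Qed.

Lemma coinv_null_geo x a k (y : chain k.+1) : coinv_null x (geo x a y - y *+ a).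
Proof.
rewrite /geo -[X in _ *+ X]card_ord -sumr_const -sumrB.
by apply: coinv_null_sum => j _; apply: coinv_null_lact; rewrite mem_cycle.
Qed.

Lemma bd_iter_geo x a i k (c : chain k.+1) :
  bd (iter i (geo x a (k := _)) c) = iter i (geo x a (k := _)) (bd c).
Proof. by elim: i => //= i IH; rewrite bd_geo IH. Qed.

Lemma pdiff_iter_geo x a i n k (c : chain k) :
  pdiff x n (iter i (geo x a (k := _)) c) =
    iter i (geo x a (k := _)) (pdiff x n c).
Proof. by elim: i => //= i IH; rewrite -geo_pdiff IH. Qed.

Lemma coinv_null_iter_geo x a i k (y : chain k.+1) :
  coinv_null x (iter i (geo x a (k := _)) y - y *+ a ^ i).
Proof.
elim: i => [|i IH] /=; first by rewrite expn0 mulr1n subrr; apply: coinv_null0.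
apply: (coinv_null_trans (coinv_null_geo _ _ _)); rewrite expnSr mulrnA -mulrnBl.
exact: coinv_nullMn.
Qed.

(** A chain map from the periodic resolution for x ^+ a to that for x is
    multiplication by a power of geo that increases in every odd degree. *)
Lemma geo_res x a W : <[x ^+ a]>%g = <[x]>%g -> res_seq x W ->
  res_seq (x ^+ a)%g (fun n => iter (uphalf n) (geo x a (k := _)) (W n)).
Proof.
move=> xa [W0 Wn]; split=> // n; rewrite bd_iter_geo Wn -pdiff_iter_geo.
rewrite uphalfE /= -[X in _ = pdiff _ _ (iter X _ _)]/(uphalf n).
rewrite uphalf_half /pdiff; case: (odd n) => /=; first by rewrite xa.
by rewrite add0n delta_geo.
Qed.

(** Translating by g^-1 and multiplying by powers of geo give two sequences over
    the periodic resolution for x ^+ a; on coinvariants geo is multiplication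
    by a. *)
Lemma conj_pchain x g a i : (x ^ g = x ^+ a)%g ->
  coinv_null x (lact g^-1%g (pchain x i.*2.+1) - pchain x i.*2.+1 *+ a ^ i.+1).
Proof.
move=> xg; have xa : <[x ^+ a]>%g = <[x]>%g.
  apply/eqP; rewrite eqEcard cycle_subG mem_cycle /=.
  by rewrite -!orderE -xg orderJ.
have := lact_res g^-1%g (pchain_res x); rewrite invgK xg => r1.
have r2 := geo_res xa (pchain_res x).
have [b [b' e]] := res_unique r1 r2 i.*2.
apply: coinv_null_trans; last exact: coinv_null_iter_geo.
have u : uphalf i.*2.+1 = i.+1 by rewrite /= doubleK.
rewrite {}u in e; exists (geo x a b), b'; rewrite e.
by rewrite /pdiff odd_double delta_geo.
Qed.

Lemma proj_norm k (A : {set G}) (c : chain k.+1) :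
  proj (norm A c) = proj c *+ #|A|.
Proof.
rewrite /norm (raddf_sum (@proj _ k)) /= -sumr_const.
by apply: eq_bigr => g _; rewrite proj_lact.
Qed.

(** A chain that vanishes in the G-coinvariants has a transfer that vanishes in
    the coinvariants under <[x]>. *)
Lemma norm_transfer0 x k (y : chain k.+1) : proj y = 0 ->
  norm <[x]> (norm (reps x) y) = 0.
Proof. by move=> y0; rewrite norm_reps norm_proj0. Qed.

(** The transfer of a lift of z is a cycle of the coinvariants under <[x]>, and
    its projection is z multiplied by the index. *)
Lemma bar_generate x n (z : bar_chain G n.+1) : bar_boundary z = 0 ->
  exists k c, z *+ #|reps x| = proj (pchain x n.+1) *~ k + bar_boundary c
              /\ (odd n -> k = 0).
Proof.
have [c <-] := proj_surj z; rewrite -proj_bd => /(norm_transfer0 x).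
rewrite -bd_norm => /coinv_cycle_generated[k [b [b' [e k0]]]]; exists k, (proj b).
split=> //; rewrite -proj_norm e 2!projD projMz -proj_bd.
by rewrite proj_delta addr0.
Qed.

Lemma bar_pchain_cycle x n :
  ~~ odd n -> bar_boundary (proj (pchain x n.+1)) = 0.
Proof.
move=> nn; rewrite -proj_bd bd_pchain /pdiff (negbTE nn).
exact: proj_delta.
Qed.

Lemma bar_pchain_order x n : ~~ odd n ->
  proj (pchain x n.+1) *+ #[x]%g = bar_boundary (proj (pchain x n.+2)).
Proof. by move=> nn; rewrite -proj_bd bd_pchain /pdiff /= nn proj_norm. Qed.

Lemma bar_pchain_conj x g a i : (x ^ g = x ^+ a)%g ->
  exists c, proj (pchain x i.*2.+1) - proj (pchain x i.*2.+1) *+ a ^ i.+1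
            = bar_boundary c.
Proof.
move=> /(conj_pchain i)/coinv_null_proj[c].
by rewrite projB proj_lact projMn; exists c.
Qed.

(** The chase of coinv_cycle_generated run downwards: from an expression of
    k times pchain in degree n.+1 one gets an expression in degree n of the
    other parity, and in degree 0 the augmentation reads k as a multiple of
    #[x]. *)
Lemma pchain_order x k i :
  coinv_null x (pchain x i.*2.+1 *+ k) -> (#[x]%g %| k)%N.
Proof.
have descend n b b' : pchain x n.+1 *+ k = delta x b + bd b' -> ~~ odd n ->
    exists y, pchain x n *+ k = bd b + norm <[x]> y.
  move=> e nn; have := congr1 (@bd _ _) e.
  rewrite bdMn bdD bd_bd addr0 bd_pchain bd_delta /pdiff (negbTE nn).
  move=> /eqP; rewrite -deltaMn -subr_eq0 -deltaB => /eqP/delta0_norm[y ey].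
  by exists y; rewrite -ey addrC subrK.
elim: i => [|i IH] [b [b' /descend[|y e]]]; rewrite /= ?odd_double //.
  have := congr1 (@bd _ _) e.
  rewrite bdMn bdD bd_bd add0r bd_norm norm0 bd_pchain0.
  have [m ->] := chain0E (bd y) => /ffunP/(_ [ffun=> 1%g]).
  rewrite !ffunMnE ffunMzE !ffunE mulrzz mul1r -[m *+ _]mulr_natr !natz.
  by move=> /(congr1 absz); rewrite abszM /= => ->; rewrite dvdn_mull.
apply: IH; have := congr1 (@bd _ _) e.
rewrite bdMn bdD bd_bd add0r bd_norm bd_pchain /pdiff /= odd_double /=.
move=> /eqP; rewrite -normMn -subr_eq0 -normB => /eqP/norm0_delta[b'' eb].
by exists b'', y; rewrite -eb subrK.
Qed.

End Resolution.

(** * Transfer to a subgroup of prime order *)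

Section Transfer.
Local Open Scope ring_scope.
Variables (G : finGroupType) (x : G).
Hypothesis x_prime : prime #[x]%g.

Notation P := <[x]>%g.
Notation N := 'N(<[x]>)%g.

Lemma coinv_null_rep k (c : {ffun {ffun 'I_k.+1 -> G} -> int}) g :
  coinv_null x (lact (rep x g) c - lact g c).
Proof.
case: (repP x g) => h hx e; rewrite {2}e -lactM -opprB.
by apply: coinv_nullN; apply: coinv_null_lact.
Qed.

Lemma coinv_null_norm n : ~~ odd n -> coinv_null x (norm P (pchain x n.+1)).
Proof.
move=> nn; have := bd_pchain x n.+1; rewrite /pdiff /= nn => <-.
exact: coinv_null_bd.
Qed.

(** In prime order one nontrivial element of <[x]> conjugated into <[x]>
    already generates it. *)
Lemma prime_normalizes g h : h \in P -> h != 1%g -> (h ^ g)%g \in P -> g \in N.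
Proof.
move=> hx h1 hg; rewrite inE.
suff e : P = <[h]>%g by rewrite {1}e -cycleJ cycle_subG.
apply/esym/eqP; rewrite eqEcard cycle_subG hx /= -!orderE.
have hd : (#[h]%g %| #[x]%g)%N by apply: cardSg; rewrite cycle_subG.
have /primeP[_ /(_ _ hd)] := x_prime.
by rewrite order_eq1 (negbTE h1) /= => /eqP ->.
Qed.

(** For t outside the normalizer the representatives in the double coset of t
    are, up to the left action of <[x]>, the products t * h with h in <[x]>, so
    that the translates over them add up to the translate by t of a norm, which
    is a boundary. *)
Lemma coinv_null_outside n : ~~ odd n ->
  coinv_null x (\sum_(t in reps x :\: N) lact t (pchain x n.+1)).
Proof.
move=> nn; pose dc t := (P :* t * P)%g.
rewrite (partition_big dc xpredT) //=; apply: coinv_null_sum => A _.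
case: (pickP (fun t => (t \in reps x :\: N) && (dc t == A))) => [t0|none]; last first.
  by rewrite big_pred0 //; apply: coinv_null0.
move=> /andP[]; rewrite inE => /andP[t0N t0T] /eqP <-{A}.
pose f h := rep x (t0 * h)%g.
have xN h : h \in P -> h \in N by apply: subsetP (normG _) _.
have f_inj : {in P &, injective f}.
  move=> h h' hx hx' /eqP; rewrite rep_eq invMg mulgA -[(_ * h * _)%g]mulgA.
  move=> e; apply/eqP; rewrite eq_mulgV1; apply: contraR t0N => h1.
  rewrite -groupV; apply: prime_normalizes h1 _; first by rewrite groupM ?groupV.
  by rewrite conjgE invgK mulgA.
rewrite (eq_bigl (mem [set f h | h in P])) => [|t]; last first.
  rewrite inE /=; apply/andP/imsetP => [[/andP[tN tT] /eqP e]|[h hx ->]].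
    have : t \in dc t0.
      rewrite -e -[X in X \in _]mulg1.
      by apply: mem_mulg (group1 _); apply: rcoset_refl.
    case/mulsgP=> _ b /rcosetP[a ax ->] bx et; exists b => //.
    by rewrite /f -(rep_id tT) et -mulgA [in LHS]repM.
  case: (repP x (t0 * h)%g) => k kx e; rewrite rep_in_reps andbT; split.
    apply: contra t0N => fN; have -> : t0 = (k * rep x (t0 * h)%g * h^-1)%g.
      by rewrite -e mulgK.
    by rewrite !groupM ?groupV ?(xN k) ?(xN h).
  apply/eqP; have -> : f h = (k^-1 * t0 * h)%g by rewrite -mulgA e mulKg.
  by rewrite /dc !rcosetM rcoset_id ?groupV // -!mulgA lcoset_id.
rewrite big_imset //=.
rewrite -[X in coinv_null x X](subrK (lact t0 (norm P (pchain x n.+1)))).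
apply: coinv_nullD.
  rewrite /norm (raddf_sum (@lact _ _ t0)) /= -sumrB.
  apply: coinv_null_sum => h hx.
  by rewrite lactM; apply: coinv_null_rep.
have := bd_pchain x n.+1; rewrite /pdiff /= nn => <-; rewrite -bd_lact.
exact: coinv_null_bd.
Qed.

(** If the generator bounds, its transfer is null.  The transfer is the sum of a
    null part, from outside the normalizer, and of one copy of the generator for
    each coset inside; so x has order dividing the number of these cosets, which
    divides the index of <[x]>. *)
Lemma bar_pchain_nonbound i :
  (forall g a, (x ^ g = x ^+ a)%g -> a ^ i.+1 = 1 %[mod #[x]%g]) ->
  ~~ (#[x]%g %| #|reps x|)%N ->
  forall c, proj (pchain x i.*2.+1) <> bar_boundary c.
Proof.
move=> fusion qT c Vc; set v := pchain x i.*2.+1 in Vc *.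
have ni : ~~ odd i.*2 by rewrite odd_double.
have [c' cc'] := proj_surj c.
have : norm P (norm (reps x) (v - bd c')) = 0.
  by apply: norm_transfer0; rewrite projB Vc -cc' proj_bd subrr.
rewrite normB -bd_norm => /norm0_delta[b eb].
have trV_null : coinv_null x (norm (reps x) v).
  by exists b, (norm (reps x) c'); rewrite -eb subrK.
have pV_null : coinv_null x (v *+ #[x]%g).
  rewrite -[X in coinv_null x X](subKr (norm P v)); apply: coinv_nullD.
    exact: coinv_null_norm.
  apply: coinv_nullN; rewrite orderE /norm -sumr_const -sumrB.
  by apply: coinv_null_sum => h; apply: coinv_null_lact.
have inside t : t \in N -> coinv_null x (lact t v - v).
  move=> tN; have /cycleP[a xa] : (x ^ t^-1)%g \in P.
    by rewrite memJ_norm ?groupV ?cycle_id.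
  have := conj_pchain i xa; rewrite invgK => /coinv_null_trans; apply.
  rewrite (divn_eq (a ^ i.+1) #[x]%g) (fusion _ _ xa) modn_small ?prime_gt1 //.
  by rewrite mulrnDr addrK mulnC mulrnA; apply: coinv_nullMn.
have : coinv_null x (v *+ #|reps x :&: N|).
  rewrite -[X in coinv_null x X](subKr (norm (reps x) v)).
  apply: coinv_nullD => //; apply: coinv_nullN.
  rewrite /norm (big_setID N) /= addrAC.
  apply: coinv_nullD; last exact: coinv_null_outside.
  rewrite -sumr_const -sumrB; apply: coinv_null_sum => t.
  rewrite inE => /andP[_].
  exact: inside.
move=> /pchain_order q_TN; case/negP: qT; apply: dvdn_trans q_TN _.
have xN : P \subset N by apply: normG.
have := cardSg (subsetT N); rewrite (@card_reps _ x N) => [|h g hx]; last first.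
  by rewrite groupMl // (subsetP xN).
rewrite (@card_reps _ x setT) => [|h g hx]; last by rewrite !inE.
by rewrite setIT dvdn_pmul2r ?order_gt0.
Qed.

End Transfer.

(** * Primary part of a group generated up to an index *)

Section Primary.
Local Open Scope ring_scope.
Variables (p : nat) (A : zmodType) (m : nat) (u : A).
Hypotheses (p_prime : prime p) (pm : ~~ (p %| m)%N) (pu : u *+ p = 0).
Hypothesis gen : forall a : A, exists k : int, a *+ m = u *~ k.

(** On the p-primary part multiplication by m, which is prime to p, is
    invertible. *)
Lemma primary_multiple (a : A) : a \in primary_pred p (A := A) ->
  exists k, a = u *+ k.
Proof.
move=> /asboolP[e ae].
have u_nat (k : int) : exists l, u *~ k = u *+ l.
  case: k => k; first by exists k.
  exists (p * k.+1 - k.+1)%N; rewrite NegzE mulrNz mulrnBr.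
    by rewrite mulrnA pu mul0rn sub0r.
  by rewrite leq_pmull ?prime_gt0.
have cop : coprime (p ^ e) m by rewrite coprimeXl ?prime_coprime.
have [k1 k1E] := gen a; have [l el] := u_nat k1.
have pe0 : (0 < p ^ e)%N by rewrite expn_gt0 prime_gt0.
case: (posnP m) => [m0|m_gt0]; first by move: pm; rewrite m0 dvdn0.
case: (egcdnP (p ^ e) m_gt0) => km kn e1 _.
rewrite gcdnC (eqP cop) in e1.
exists (l * km)%N; rewrite mulrnA -el -k1E -mulrnA mulnC e1.
by rewrite mulrnDr mulnC mulrnA ae mul0rn add0r.
Qed.

Lemma primary_trivial : u = 0 -> zmod_trivial (primary_part p A).
Proof.
move=> u0 [a ap]; apply: val_inj => /=; have [k ->] := primary_multiple ap.
by rewrite u0 mul0rn.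
Qed.

Lemma primary_Zp : u <> 0 -> zmod_iso (primary_part p A) 'Z_p.
Proof.
move=> u0; have p_gt1 := prime_gt1 p_prime.
have up : u \in primary_pred p (A := A).
  by apply/asboolP; exists 1%N; rewrite expn1.
have u_mod k : u *+ k = u *+ (k %% p).
  by rewrite {1}(divn_eq k p) mulrnDr mulnC mulrnA pu mul0rn add0r.
have u_inj k l : (k < p)%N -> (l < p)%N -> u *+ k = u *+ l -> k = l.
  wlog : k l / (k <= l)%N => [W kp lp e|kl kp lp e].
    by case: (leqP k l) => [/W|/ltnW/W/(_ lp kp (esym e))/esym]; apply.
  apply/eqP; rewrite eqn_leq kl -subn_eq0 /=; apply/negPn/negP => lk.
  have : u *+ (l - k) = 0 by rewrite mulrnBr // e subrr.
  have cop : coprime p (l - k).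
    rewrite prime_coprime // gtnNdvd ?lt0n //.
    by apply: leq_ltn_trans lp; rewrite leq_subr.
  have lk0 : (0 < l - k)%N by rewrite lt0n.
  move=> u_lk; apply: u0; case: (egcdnP p lk0) => km kn e1 _.
  rewrite gcdnC (eqP cop) in e1; rewrite -[u]mulr1n.
  have := congr1 (fun c => u *+ c) e1.
  by rewrite mulnC mulrnA u_lk mul0rn mulrnDr mulnC mulrnA pu mul0rn add0r.
pose w : primary_part p A := PrimaryPart up.
have valMn (a : primary_part p A) k : val (a *+ k) = val a *+ k.
  by elim: k => // k IH; rewrite !mulrS -IH.
have ex (a : primary_part p A) : exists i : 'Z_p, a == w *+ i.
  have [k e] := primary_multiple (valP a).
  exists (inZp k); apply/eqP/val_inj; rewrite valMn [LHS]e u_mod /=.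
  by rewrite Zp_cast.
pose f a : 'Z_p := xchoose (ex a).
have fP a : a = w *+ f a by apply/eqP; apply: (xchooseP (ex a)).
have w_inj (i j : 'Z_p) : w *+ i = w *+ j -> i = j.
  move=> /(congr1 val); rewrite !valMn /= => e.
  by apply/val_inj/u_inj => //; rewrite -[X in (_ < X)%N](Zp_cast p_gt1) ltn_ord.
have w_mod k : w *+ k = w *+ (k %% p).
  by apply: val_inj; rewrite !valMn /= u_mod.
have Zadd (i j : 'Z_p) : w *+ (i + j)%R = w *+ i + w *+ j.
  rewrite -mulrnDr [RHS]w_mod; congr (_ *+ _).
  exact: (congr1 (fun q => (i + j) %% q)%N (Zp_cast p_gt1)).
have f_add : zmod_morphism f.
  move=> a b; apply: w_inj; rewrite -fP; apply/eqP.
  by rewrite subr_eq {2}(fP b) -Zadd subrK -fP.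
pose F := GRing.isZmodMorphism.Build _ _ f f_add.
pose fA : {additive primary_part p A -> 'Z_p} := HB.pack f F.
exists fA; exists (fun i : 'Z_p => w *+ i) => [a|i]; first by rewrite -fP.
by apply: w_inj; rewrite -fP.
Qed.

End Primary.

(** * Groups with a Sylow subgroup of prime order *)

Section Homology.
Local Open Scope ring_scope.
Variable G : finGroupType.

Definition cls n (z : bar_cycles G n) : homology G n := \pi%qT z.

Lemma clsB n : zmod_morphism (@cls n).
Proof. by move=> y z; rewrite /cls raddfB. Qed.

HB.instance Definition _ n :=
  GRing.isZmodMorphism.Build (bar_cycles G n) (homology G n) (@cls n) (@clsB n).

Lemma cls_surj n (a : homology G n) : exists z, a = cls z.
Proof. by exists (generic_quotient.repr a); rewrite /cls reprK. Qed.

Lemma cls_eq0 n (z : bar_cycles G n) :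
  cls z = 0 <-> exists c, bar_boundary c = val z.
Proof.
have -> : (cls z = 0) <-> (z \in @bar_bound G n).
  rewrite -[z in X in _ <-> X]subr0 Quotient.idealrBE.
  by split=> [e|/eqP e]; [apply/eqP; rewrite -/(cls z) e -(raddf0 (@cls n))|
    rewrite /cls e -(raddf0 (@cls n))].
by split=> [/asboolP|e]; last exact/asboolP.
Qed.

Lemma card_repsG (x : G) : (#|reps x| * #[x]%g = #|G|)%N.
Proof.
rewrite -cardsT (@card_reps _ x setT) ?setIT // => h g hx; by rewrite !inE.
Qed.

Lemma cycleS n (z : bar_cycles G n.+1) : bar_boundary (val z) = 0.
Proof. exact/eqP/(valP z). Qed.

Lemma valMn n (z : bar_cycles G n) k : val (z *+ k) = val z *+ k.
Proof. by elim: k => // k IH; rewrite !mulrS -IH. Qed.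

Lemma valMz n (z : bar_cycles G n) k : val (z *~ k) = val z *~ k.
Proof.
case: k => k; first exact: valMn.
by rewrite NegzE !mulrNz; exact: (congr1 -%R (valMn z k.+1)).
Qed.

(** Stated for any x, so that x = 1 covers the primes not dividing the order. *)
Lemma homology_trivial p (x : G) n : prime p -> ~~ (p %| #|reps x|)%N ->
  (~~ odd n -> exists c, proj (pchain x n.+1) = bar_boundary c) ->
  zmod_trivial (primary_part p (homology G n.+1)).
Proof.
move=> p_prime pT Vb; apply: (@primary_trivial p _ #|reps x| 0) => //.
  by rewrite mul0rn.
move=> a; exists 0; have [z ->] := cls_surj a; rewrite mulr0z -raddfMn.
apply/cls_eq0; rewrite valMn.
have [k [c [-> k0]]] := bar_generate x (cycleS z).
case n_odd: (odd n); first by exists c; rewrite k0 // mulr0z add0r.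
have [|c' ->] := Vb; first by rewrite n_odd.
by exists (c' *~ k + c); rewrite raddfD raddfMz.
Qed.

Lemma homology_Zp p (x : G) n : prime p -> #[x]%g = p ->
  ~~ (p %| #|reps x|)%N -> ~~ odd n ->
  (forall c, proj (pchain x n.+1) <> bar_boundary c) ->
  zmod_iso (primary_part p (homology G n.+1)) 'Z_p.
Proof.
move=> p_prime xp pT nn Vb.
have Vc : proj (pchain x n.+1) \in @bar_cycle G n.+1 by apply/eqP/bar_pchain_cycle.
pose v := BarCycle Vc.
apply: (@primary_Zp p _ #|reps x| (cls v)) => //.
- rewrite -raddfMn; apply/cls_eq0; rewrite valMn /= -xp bar_pchain_order //.
  by exists (proj (pchain x n.+2)).
- move=> a; have [z ->] := cls_surj a.
  have [k [c [e _]]] := bar_generate x (cycleS z); exists k.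
  apply/eqP; rewrite -subr_eq0 -raddfMn -(raddfMz (@cls _)) -raddfB.
  apply/eqP/cls_eq0; exists c.
  have -> : val (z *+ #|reps x| - v *~ k) = val z *+ #|reps x| - val v *~ k.
    by rewrite -valMn -valMz.
  by rewrite e addrC addKr.
- by move/cls_eq0 => [c] /esym /Vb.
Qed.

Theorem homology_coprime p n : prime p -> ~~ (p %| #|G|)%N -> (0 < n)%N ->
  zmod_trivial (primary_part p (homology G n)).
Proof.
case: n => // n p_prime pG _; apply: (@homology_trivial p 1%g) => // [|nn].
  by apply: contra pG => h; rewrite -(card_repsG 1%g) dvdn_mulr.
have := bar_pchain_order (1%g : G) nn; rewrite order1 mulr1n.
by exists (proj (pchain 1%g n.+2)).
Qed.

(** In degree 2 i - 1 the generator v satisfies p v = 0 and (a ^ i - 1) v = 0 up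
    to boundaries, for every a with x conjugate to x ^+ a.  If d divides i
    these relations are all consequences of p v = 0 and v survives; otherwise
    one of them has a ^ i - 1 prime to p and v bounds. *)
Theorem homology_cyclic_sylow p (x : G) d n : prime p -> #[x]%g = p ->
  ~~ (p ^ 2 %| #|G|)%N ->
  (exists g a, (x ^ g = x ^+ a)%g /\
     forall i, a ^ i = 1 %[mod p] -> (d %| i)%N) ->
  (forall g a, (x ^ g = x ^+ a)%g -> a ^ d = 1 %[mod p]) ->
  (0 < n)%N ->
  ((exists k, 1 <= k /\ n = 2 * d * k - 1)%N ->
      zmod_iso (primary_part p (homology G n)) 'Z_p) /\
  (~ (exists k, 1 <= k /\ n = 2 * d * k - 1)%N ->
      zmod_trivial (primary_part p (homology G n))).
Proof.
case: n => // n p_prime xp pG [g [a [xg ad]]] fusion _.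
have pT : ~~ (p %| #|reps x|)%N.
  apply: contra pG => h; rewrite -(card_repsG x) xp.
  by rewrite expnS expn1 dvdn_mul.
split=> [[k [k_gt0 nk]]|no_k].
  have d_gt0 : (0 < d)%N by case: d nk {ad fusion}; rewrite ?muln0 ?mul0n.
  have e : n = (d * k).-1.*2.
    have : (0 < d * k)%N by rewrite muln_gt0 d_gt0.
    by move: nk; rewrite -mulnA; lia.
  rewrite e; apply: (@homology_Zp p x) => //; first by rewrite odd_double.
  apply: bar_pchain_nonbound; rewrite xp // => h b xb.
  rewrite prednK ?muln_gt0 ?d_gt0 // expnM -modnXm (fusion _ _ xb).
  by rewrite modnXm exp1n.
apply: (@homology_trivial p x) => // nn.
have e : n = n./2.*2 by rewrite -[LHS]odd_double_half (negbTE nn).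
have [c ec] := bar_pchain_conj n./2 xg.
have [c1 ec1] : exists c1, proj (pchain x n./2.*2.+1) *+ p = bar_boundary c1.
  by rewrite -xp bar_pchain_order ?odd_double //; exists (proj (pchain x n./2.*2.+2)).
rewrite e; set v := proj _ in ec ec1 *; set q := (a ^ n./2.+1)%N in ec.
have q1 : q != 1 %[mod p].
  apply/eqP => /ad /dvdnP[k ek]; apply: no_k; exists k; split.
    by case: k ek => //.
  by rewrite -mulnA [(d * k)%N]mulnC -ek; lia.
(* v is a combination of p v and of q v for the new q, one less than a ^ i *)
case: q q1 ec => [|q] q1 ec; first by exists c; rewrite -ec mulr0n subr0.
have cq : v *+ q = bar_boundary (- c).
  by rewrite raddfN /= -ec mulrS opprB addrAC subrr add0r.
have pq : ~~ (p %| q)%N.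
  by apply: contra q1 => /dvdnP[k ->]; rewrite -addn1 modnMDl.
have q_gt0 : (0 < q)%N by case: q pq {q1 ec cq}; rewrite ?dvdn0.
case: (egcdnP p q_gt0) => kq kp ek _; move: ek.
have -> : gcdn q p = 1%N by apply/eqP; rewrite gcdnC -/(coprime _ _) prime_coprime.
move=> ek; exists (- c *+ kq - c1 *+ kp).
rewrite raddfB !raddfMn /= -cq -ec1 -!mulrnA [(q * _)%N]mulnC ek mulrnDr.
by rewrite mulNrn -mulrnA (mulnC kp) addrAC subrr add0r.
Qed.

End Homology.

(** * Permutations as tables *)

Section Encoding.
Variable N : nat.
Local Notation perm := 'S_N.+1.

(** Tables of natural numbers are used instead of elements of the symmetric
    group because their products evaluate quickly.  The product of tables
    follows the convention of permutations: the left factor acts first. *)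
Definition enc (g : perm) : seq nat := [seq val (g i) | i <- enum 'I_N.+1].
Definition pone : seq nat := iota 0 N.+1.
Definition pmul (s t : seq nat) : seq nat := [seq nth 0 t i | i <- s].
Definition pinv (s : seq nat) : seq nat := [seq index i s | i <- pone].
Definition ppow (s : seq nat) k : seq nat := iter k (pmul s) pone.

Lemma nth_enc g (i : 'I_N.+1) : nth 0 (enc g) i = g i.
Proof. by rewrite (nth_map i) ?size_enum_ord // nth_ord_enum. Qed.

Lemma enc_inj : injective enc.
Proof.
by move=> g h e; apply/permP=> i; apply: val_inj; rewrite /= -!nth_enc e.
Qed.

Lemma enc1 : enc 1 = pone.
Proof.
by rewrite /pone -val_enum_ord; apply: eq_map => i; rewrite perm1.
Qed.

Lemma encM g h : enc (g * h) = pmul (enc g) (enc h).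
Proof.
by rewrite /pmul -map_comp; apply: eq_map => i /=; rewrite permM nth_enc.
Qed.

Lemma encV g : enc g^-1 = pinv (enc g).
Proof.
rewrite /pinv /pone -val_enum_ord -map_comp; apply: eq_map => i /=.
have e : val i = (fun j => val (g j)) (g^-1%g i) by rewrite /= permKV.
rewrite [X in index X]e /enc (@index_map _ _ (fun j => val (g j))) ?index_enum_ord //.
by move=> c d /val_inj/perm_inj.
Qed.

Lemma encX g k : enc (g ^+ k) = ppow (enc g) k.
Proof. by elim: k => [|k IH]; rewrite ?enc1 // expgS encM IH. Qed.

(** Tables of transpositions, cycles and products of cycles, following the
    definitions of cyc and cycs. *)
Definition ptrans a b : seq nat :=
  [seq if i == a then b else if i == b then a else i | i <- pone].
Definition pcyc (s : seq nat) : seq nat :=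
  foldr (fun j t => pmul (ptrans (head 0 s) j) t) pone (behead s).
Definition pcycs (ss : seq (seq nat)) : seq nat :=
  foldr (fun s t => pmul (pcyc s) t) pone ss.

Lemma enc_tperm a b : a <= N -> b <= N ->
  enc (tperm (inord a) (inord b)) = ptrans a b.
Proof.
move=> aN bN; rewrite /ptrans /pone -val_enum_ord -map_comp; apply: eq_map => i /=.
have E c : c <= N -> (val i == c) = (i == inord c).
  by move=> cN; rewrite -val_eqE /= inordK.
rewrite !E //; case: tpermP => [->|->|/eqP/negPf-> /eqP/negPf-> //].
  by rewrite eqxx inordK.
by case: eqP => [<-|_]; rewrite ?eqxx inordK.
Qed.

Lemma enc_cyc s : all (leq^~ N) s -> enc (cyc N s) = pcyc s.
Proof.
rewrite /cyc /pcyc; case: s => [|a s] /=; first by rewrite big_nil enc1.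
case/andP=> aN; elim: s => [|b s IH] /=; first by rewrite big_nil enc1.
by case/andP=> bN sN; rewrite big_cons encM enc_tperm // IH.
Qed.

Lemma enc_cycs ss : all (all (leq^~ N)) ss -> enc (cycs N ss) = pcycs ss.
Proof.
rewrite /cycs /pcycs; elim: ss => [|s ss IH] /=; first by rewrite big_nil enc1.
by case/andP=> sN ssN; rewrite big_cons encM enc_cyc // IH.
Qed.

Definition encodes (K : {set perm}) (s : seq nat) : Prop :=
  exists2 g, g \in K & enc g = s.

Lemma encodesM (K : {group perm}) s t :
  encodes K s -> encodes K t -> encodes K (pmul s t).
Proof.
by move=> [g gK <-] [h hK <-]; exists (g * h)%g; rewrite ?encM ?groupM.
Qed.

Lemma encodesV (K : {group perm}) s : encodes K s -> encodes K (pinv s).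
Proof. by move=> [g gK <-]; exists g^-1%g; rewrite ?encV ?groupV. Qed.

Lemma encodes1 (K : {group perm}) : encodes K pone.
Proof. by exists 1%g; rewrite ?enc1. Qed.

(** A straight line program: the instruction (i, j) appends the quotient of
    entries i and j. *)
Fixpoint slp (L : seq (seq nat)) (prog : seq (nat * nat)) : seq (seq nat) :=
  if prog is (i, j) :: prog' then
    slp (rcons L (pmul (nth pone L i) (pinv (nth pone L j)))) prog'
  else L.

Lemma slp_encodes (K : {group perm}) prog L :
  (forall s, s \in L -> encodes K s) ->
  forall s, s \in slp L prog -> encodes K s.
Proof.
elim: prog L => //= -[i j] prog IH L LK; apply: IH => s.
have nthK k : encodes K (nth pone L k).
  case: (ltnP k (size L)) => kL; first by apply: LK; rewrite mem_nth.
  by rewrite nth_default //; apply: encodes1.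
rewrite mem_rcons inE => /orP[/eqP->|/LK //].
by apply: encodesM => //; apply: encodesV.
Qed.

Definition gen_group (S : seq (seq nat)) : {group perm} :=
  <<[set g | enc g \in S]>>%G.

Definition add_images b (T us : seq (seq nat)) : seq (seq nat) :=
  foldl (fun T u => if nth 0 u b \in [seq nth 0 t b | t <- T] then T
                    else rcons T u) T us.

(** Breadth-first search of the orbit of b: the i-th transversal element found
    so far is multiplied by all generators, and the products reaching new
    points are appended. *)
Definition transv b (S : seq (seq nat)) : seq (seq nat) :=
  foldl (fun T i => add_images b T [seq pmul (nth pone T i) s | s <- S])
        [:: pone] pone.

(** Strong generators are nested: those of a stabilizer are the given ones that
    fix the point. *)
Definition fixing b (S : seq (seq nat)) := [seq s <- S | nth 0 s b == b].

Fixpoint stab_chain (base : seq nat) (S : seq (seq nat)) :=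
  if base is b :: base' then (b, transv b S) :: stab_chain base' (fixing b S)
  else [::].

(** Division by transversal elements along a chain.  The test that the division
    can be undone makes success meaningful for an arbitrary list s.  The
    conditional stops call-by-value evaluation from sifting at every t. *)
Fixpoint sift (C : seq (nat * seq (seq nat))) (s : seq nat) : bool :=
  if C is (b, T) :: C' then
    has (fun t => if nth 0 t b == nth 0 s b then
                    let r := pmul s (pinv t) in (pmul r t == s) && sift C' r
                  else false) T
  else s == pone.

(** Schreier criterion for the chain: each product of a transversal element and
    a generator sifts, and only the identity fixes all base points. *)
Fixpoint complete (base : seq nat) (S : seq (seq nat)) : bool :=
  if base is b :: base' then
    let T := transv b S in
    let C := (b, T) :: stab_chain base' (fixing b S) in
    [&& b <= N, uniq [seq nth 0 t b | t <- T],
        all (sift C) [seq pmul t s | t <- T, s <- S]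
      & complete base' (fixing b S)]
  else all (pred1 pone) S.

Fixpoint orbit_sizes (base : seq nat) (S : seq (seq nat)) : seq nat :=
  if base is b :: base' then size (transv b S) :: orbit_sizes base' (fixing b S)
  else [::].

Definition tables (S : seq (seq nat)) :=
  forall s, s \in S -> exists g, enc g = s.

Lemma tables_fixing b S : tables S -> tables (fixing b S).
Proof. by move=> ST s; rewrite mem_filter => /andP[_ /ST]. Qed.

Lemma gen_encodes S s : tables S -> s \in S -> encodes (gen_group S) s.
Proof.
move=> ST sS; have [g e] := ST s sS; exists g => //.
by apply: mem_gen; rewrite inE e.
Qed.

Lemma add_imagesP b us (A : seq nat -> Prop) T :
  (forall u, u \in us -> A u) -> (forall t, t \in T -> A t) ->
  forall t, t \in add_images b T us -> A t.
Proof.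
rewrite /add_images; elim: us T => //= u us IH T usA TA.
apply: IH => [v vus|v]; first by apply: usA; rewrite inE vus orbT.
case: ifP => _; first exact: TA.
by rewrite mem_rcons inE => /orP[/eqP->|/TA//]; apply: usA; rewrite mem_head.
Qed.

Lemma transv_encodes b S : tables S ->
  forall t, t \in transv b S -> encodes (gen_group S) t.
Proof.
rewrite /transv => ST; set step := (X in foldl X).
suff step_in js T : (forall t, t \in T -> encodes (gen_group S) t) ->
    forall t, t \in foldl step T js -> encodes (gen_group S) t.
  by apply: step_in => t; rewrite inE => /eqP->; apply: encodes1.
elim: js T => //= i js IH T TK; apply: IH; apply: add_imagesP => //.
move=> u /mapP[s sS ->]; apply: encodesM; last exact: gen_encodes.
case: (ltnP i (size T)) => iT; first by apply: TK; rewrite mem_nth.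
by rewrite nth_default //; apply: encodes1.
Qed.

Lemma transv_one b S : pone \in transv b S.
Proof.
have add_sub us T : {subset T <= add_images b T us}.
  rewrite /add_images; elim: us T => [|u us IH] T t tT //=; apply: IH.
  by case: ifP => // _; rewrite mem_rcons inE tT orbT.
rewrite /transv; set step := (X in foldl X).
suff step_in js T : pone \in T -> pone \in foldl step T js.
  by apply: step_in; rewrite mem_head.
by elim: js T => //= i js IH T TK; apply: IH; apply: add_sub.
Qed.

Lemma gen_fixing_sub b S : gen_group (fixing b S) \subset gen_group S.
Proof.
apply: genS; apply/subsetP=> g; rewrite !inE mem_filter.
by case/andP.
Qed.

Lemma sift_encodes base S s : tables S ->
  sift (stab_chain base S) s -> encodes (gen_group S) s.
Proof.
elim: base S s => [|b base IH] S s ST /=.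
  by move/eqP->; apply: encodes1.
case/hasP=> t tT; case: ifP => // _ /andP[/eqP e].
case/(IH _ _ (tables_fixing ST)) => h hK eh.
rewrite -e; apply: encodesM; last exact: transv_encodes tT.
by exists h => //; exact: (subsetP (gen_fixing_sub b S) _ hK).
Qed.

Section Head.
Variables (b : nat) (base : seq nat) (S : seq (seq nat)).
Hypotheses (ST : tables S) (SC : complete (b :: base) S).
Let K := gen_group S.
Let K' := gen_group (fixing b S).

(** The products of an element fixing b with a transversal element contain 1
    and, by completeness, are closed under right multiplication by the
    generators. *)
Lemma head_factor g : g \in K ->
  exists h t, [/\ h \in K', enc t \in transv b S, t \in K & g = (h * t)%g].
Proof.
have /and4P[bN _ /allP TS _] := SC.
pose X := [set g | [exists h in K', exists t in K,
  (enc t \in transv b S) && (g == h * t)%g]].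
suff sub : K \subset X.
  move/(subsetP sub); rewrite inE => /exists_inP[h hK /exists_inP[t tK]].
  by case/andP=> tT /eqP->; exists h, t.
have X1 : 1%g \in X.
  rewrite inE; apply/exists_inP; exists 1%g; rewrite ?group1 //.
  by apply/exists_inP; exists 1%g; rewrite ?group1 // enc1 transv_one mulg1 eqxx.
have XS y s : y \in X -> enc s \in S -> (y * s)%g \in X.
  rewrite !inE => /exists_inP[h hK /exists_inP[t tK /andP[tT /eqP ->]]] sS.
  have /TS /= /hasP[u uT] :
      pmul (enc t) (enc s) \in [seq pmul t s | t <- transv b S, s <- S].
    by apply/allpairsP; exists (enc t, enc s).
  case: ifP => // _ /andP[/eqP eu].
  case/(sift_encodes (tables_fixing ST)) => k kK ek.
  have [v vK ev] := transv_encodes ST uT.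
  apply/exists_inP; exists (h * k)%g; first by rewrite groupM.
  apply/exists_inP; exists v => //; rewrite ev uT -!mulgA (inj_eq (mulgI h)).
  by apply/eqP/enc_inj; rewrite !encM -eu -ek ev.
apply/subsetP=> w /gen_prodgP[n [c cS ->]].
elim: n c cS => [|n IH] c cS; first by rewrite big_ord0.
rewrite big_ord_recr /=; apply: XS; first by apply: IH.
by have := cS ord_max; rewrite inE.
Qed.

Lemma gen_fixing_fix g : g \in K' -> g (inord b) = inord b.
Proof.
have /and4P[bN _ _ _] := SC.
move=> gK; have : K' \subset 'C[inord b | 'P]%g.
  rewrite gen_subG; apply/subsetP=> h; rewrite inE mem_filter => /andP[/eqP hb _].
  apply/astab1P/val_inj; rewrite /= apermE -nth_enc inordK //.
by move/subsetP/(_ _ gK)/astab1P.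
Qed.

Lemma transv_inj t u : enc t \in transv b S -> enc u \in transv b S ->
  t (inord b) = u (inord b) -> t = u.
Proof.
have /and4P[bN U _ _] := SC => tT uT e; apply: enc_inj.
have E v : nth 0 (enc v) b = v (inord b).
  by rewrite -nth_enc inordK.
have tT' := tT; have uT' := uT.
rewrite -index_mem in tT'; rewrite -index_mem in uT'.
rewrite -(nth_index [::] tT) -(nth_index [::] uT); congr nth; apply/eqP.
rewrite -(nth_uniq 0 _ _ U) ?size_map // !(nth_map [::]) // !nth_index //.
by rewrite !E e.
Qed.

(** If g = h * t fixes b then so does t, and distinct transversal elements move
    b to distinct points. *)
Lemma mem_gen_fixing g :
  (g \in K') = (g \in K) && (g (inord b) == inord b).
Proof.
apply/idP/andP=> [gK|[gK /eqP gb]].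
  by split; [exact: (subsetP (gen_fixing_sub b S) _ gK) | rewrite gen_fixing_fix].
have [h [t [hK tT tK e]]] := head_factor gK.
suff t1 : t = 1%g by rewrite e t1 mulg1.
apply: transv_inj => //; first by rewrite enc1 transv_one.
by move: gb; rewrite e permM gen_fixing_fix // perm1.
Qed.

Lemma card_head : #|K| = (size (transv b S) * #|K'|)%N.
Proof.
have /and4P[bN U _ _] := SC.
have E v : nth 0 (enc v) b = v (inord b) by rewrite -nth_enc inordK.
have <- : 'C_K[inord b | 'P]%g = K' :> {set _}.
  apply/setP=> g; rewrite mem_gen_fixing inE; congr (_ && _).
  by apply/astab1P/eqP; rewrite /= apermE.
rewrite -(card_orbit_stab 'P K (inord b)); congr (_ * _)%N.
rewrite cardE -(size_map val) -(size_map (fun t => nth 0 t b) (transv b S)).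
apply/perm_size/uniq_perm => //.
  by rewrite map_inj_uniq ?enum_uniq //; apply: val_inj.
move=> j; apply/mapP/mapP => [[v]|[t tT ->]].
  rewrite mem_enum => /orbitP[g gK /= <-] ->; rewrite apermE.
  have [h [t [hK tT _ ->]]] := head_factor gK.
  by exists (enc t); rewrite // E permM gen_fixing_fix.
have [g gK e] := transv_encodes ST tT; exists (g (inord b)); last by rewrite -e E.
by rewrite mem_enum; apply/orbitP; exists g.
Qed.

End Head.

End Encoding.

(** * Orders, conjugacy and stabilizers from a chain *)

Section Chains.
Variable N : nat.
Local Notation perm := 'S_N.+1.

Lemma gen_complete_nil (S : seq (seq nat)) : complete N [::] S ->
  gen_group N S = 1%g :> {set perm}.
Proof.
move=> /allP SC; apply/trivgP; rewrite gen_subG; apply/subsetP=> g.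
by rewrite !inE => /SC /= /eqP e; apply/eqP/(@enc_inj N); rewrite enc1.
Qed.

Lemma complete_tail b base (S : seq (seq nat)) :
  complete N (b :: base) S -> complete N base (fixing b S).
Proof. by case/and4P. Qed.

Lemma card_gen base (S : seq (seq nat)) : tables N S -> complete N base S ->
  #|gen_group N S| = foldr muln 1 (orbit_sizes N base S).
Proof.
elim: base S => [|b base IH] S ST SC; first by rewrite gen_complete_nil ?cards1.
rewrite (card_head ST SC) IH //; first exact: tables_fixing.
exact: complete_tail SC.
Qed.

(** Whether the table s can agree on the points pre with an element conjugating
    X to Y, tested on the points whose image under X is again in pre. *)
Definition compat (X Y pre s : seq nat) : bool :=
  all (fun i => (nth 0 X i \in pre) ==>
                (nth 0 s (nth 0 X i) == nth 0 Y (nth 0 s i))) pre.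

(** Exhaustive search: s runs through the products of transversal elements, the
    points pre are those whose image is already determined by s, and a branch
    is left as soon as it is incompatible with conjugating X to Y. *)
Fixpoint no_conj (X Y : seq nat) (C : seq (nat * seq (seq nat)))
    (pre s : seq nat) : bool :=
  if C is (b, T) :: C' then
    all (fun t => let s' := pmul t s in let pre' := b :: pre in
           if compat X Y pre' s' then no_conj X Y C' pre' s' else true) T
  else ~~ compat X Y (pone N) s.

Lemma compat_conj (x y g a : perm) pre :
  (x * g = g * y)%g -> {in pre, forall i, i <= N} ->
  {in pre, forall i, a (inord i) = g (inord i)} ->
  compat (enc x) (enc y) pre (enc a).
Proof.
move=> xg preN ag; apply/allP=> i ipre; apply/implyP=> xpre; apply/eqP.
have E (z : perm) j : j <= N -> nth 0 (enc z) j = z (inord j).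
  by move=> jN; rewrite -nth_enc inordK.
have iN := preN _ ipre; rewrite !(E x) // in xpre *.
rewrite !E ?ag //; try by rewrite -ltnS ltn_ord.
have -> : inord (x (inord i)) = x (inord i) by apply: val_inj; rewrite /= inordK.
have -> : inord (g (inord i)) = g (inord i) by apply: val_inj; rewrite /= inordK.
by rewrite -!permM xg.
Qed.

Lemma no_conj_sound base (S : seq (seq nat)) pre (x y a k : perm) :
  tables N S -> complete N base S -> {in pre, forall i, i <= N} ->
  (forall h, h \in gen_group N S ->
     {in pre, forall i, h (inord i) = inord i}) ->
  no_conj (enc x) (enc y) (stab_chain N base S) pre (enc a) ->
  k \in gen_group N S -> (x * (k * a) <> (k * a) * y)%g.
Proof.
elim: base S pre a k => [|b base IH] S pre a k ST SC preN preK /=.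
  move=> nc; rewrite (gen_complete_nil SC) => /set1P -> e; case/negP: nc.
  apply: (compat_conj e) => i; last by rewrite mul1g.
  by rewrite mem_iota ltnS => /andP[].
move=> /allP nc kK; have [h [t [hK tT tK ->]]] := head_factor ST SC kK.
have bN : b <= N by case/and4P: SC.
have preN' : {in b :: pre, forall i, i <= N}.
  by move=> i; rewrite inE => /orP[/eqP->|/preN].
have preK' h' : h' \in gen_group N (fixing b S) ->
    {in b :: pre, forall i, h' (inord i) = inord i}.
  move=> h'K i; rewrite inE => /orP[/eqP->|ip].
    exact: (gen_fixing_fix SC).
  by apply: preK => //; apply: (subsetP (gen_fixing_sub N b S) _ h'K).
move=> e; have := nc _ tT; rewrite -encM (compat_conj e) //; last first.
  by move=> i ip; rewrite -(mulgA h) [in RHS]permM (preK' h).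
move=> nc'; apply: (IH _ _ (t * a)%g h (tables_fixing ST) (complete_tail SC)
  preN' preK' nc' hK).
by rewrite !mulgA in e *.
Qed.

Lemma fix_top (A : {group perm}) :
  'C_A([set i : 'I_N.+1 | N.+1 <= i] | 'P)%g = A.
Proof.
apply/setP=> g; rewrite inE andb_idr // => gA; apply/astabP=> i.
by rewrite inE leqNgt ltn_ord.
Qed.

(** Stabilizing the points m, m + 1, ... is stabilizing m inside the stabilizer
    of m + 1, m + 2, ... *)
Lemma fix_step (A : {group perm}) m base (S : seq (seq nat)) : tables N S ->
  complete N (m :: base) S ->
  gen_group N S = 'C_A([set i : 'I_N.+1 | m.+1 <= i] | 'P)%g :> {set perm} ->
  gen_group N (fixing m S) = 'C_A([set i : 'I_N.+1 | m <= i] | 'P)%g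
    :> {set perm}.
Proof.
move=> ST SC e; apply/setP=> g; rewrite (mem_gen_fixing ST SC) e.
have E k : (g \in 'C_A([set i : 'I_N.+1 | k <= i] | 'P)%g) =
  (g \in A) && (g \in 'C([set i : 'I_N.+1 | k <= i] | 'P)%g) by apply: in_setI.
rewrite !E -andbA.
have mN : m <= N by case/and4P: SC.
congr (_ && _); apply/andP/astabP => [[/astabP gm /eqP gb] i|gm].
  rewrite inE leq_eqVlt => /orP[/eqP mi|im]; last by apply: gm; rewrite inE.
  have <- : inord m = i by apply: val_inj; rewrite /= inordK.
  by rewrite /= apermE.
split; last by apply/eqP; have := gm (inord m); rewrite inE inordK //= apermE => ->.
by apply/astabP=> i; rewrite inE => im; apply: gm; rewrite inE ltnW.
Qed.

End Chains.

(** * Homology of a subgroup of a given group *)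

Section Subgroup.
Variables (gT : finGroupType) (H : {group gT}) (p n : nat).
Hypotheses (p_prime : prime p) (n_gt0 : 0 < n).

Lemma subg_coprime : ~~ (p %| #|H|) ->
  zmod_trivial (primary_part p (homology ([subg H] : finGroupType) n)).
Proof.
move=> pH; apply: homology_coprime => //.
by rewrite -cardsT -(card_isog (isog_subg H)).
Qed.

Lemma subg_cyclic_sylow (x : gT) d : x \in H -> #[x]%g = p ->
  ~~ (p ^ 2 %| #|H|) ->
  (exists g a, [/\ g \in H, (x ^ g = x ^+ a)%g &
     forall i, a ^ i = 1 %[mod p] -> d %| i]) ->
  (forall g a, g \in H -> (x ^ g = x ^+ a)%g -> a ^ d = 1 %[mod p]) ->
  let A := primary_part p (homology ([subg H] : finGroupType) n) in
  ((exists k, 1 <= k /\ n = 2 * d * k - 1) -> zmod_iso A 'Z_p) /\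
  (~ (exists k, 1 <= k /\ n = 2 * d * k - 1) -> zmod_trivial A).
Proof.
move=> xH xp pH [g [a [gH xg ad]]] fus A.
pose y := subg H x; have yx : sgval y = x by apply: subgK.
have sgX (u : [subg H]) k : sgval (u ^+ k)%g = (sgval u ^+ k)%g.
  by elim: k => // k IH; rewrite !expgS -IH.
have sgJ (u v : [subg H]) : sgval (u ^ v)%g = (sgval u ^ sgval v)%g by [].
apply: (@homology_cyclic_sylow _ p y d n) => //.
- apply: nt_prime_order => //.
    by apply: subg_inj; rewrite sgX yx -xp expg_order.
  by apply/eqP => y1; move: p_prime; rewrite -xp -yx y1 order1.
- by rewrite -cardsT -(card_isog (isog_subg H)).
- exists (subg H g), a; split=> //; apply: subg_inj.
  by rewrite sgJ sgX yx subgK.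
- move=> h b e; apply: (fus (sgval h) b); first exact: subgP.
  by rewrite -yx -sgJ e sgX.
Qed.

End Subgroup.

(** * Certificates for the Sylow subgroups *)

Section Certificate.
Variable N : nat.
Local Notation perm := 'S_N.+1.

Definition pow_mod p b d : nat := iter d (fun y => y * b %% p) 1.

Lemma pow_modE p b d : 1 < p -> pow_mod p b d = b ^ d %% p.
Proof.
move=> p1; elim: d => [|d IH]; first by rewrite expn0 modn_small.
by rewrite /pow_mod iterS -/(pow_mod p b d) IH modnMml expnSr.
Qed.

(** X is the table of an element of order p, Y conjugates it to its a-th power,
    a has order d modulo p, p divides the group order at most once, and X is
    conjugate to no power X ^+ b with b ^ d different from 1 modulo p.  The group
    order, a unary number too large to evaluate, is only handled through its
    factors, the orbit lengths. *)
Definition certificate base (S : seq (seq nat)) p d a (X Y : seq nat) : bool :=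
  let C := stab_chain N base S in
  [&& sift N C X, sift N C Y, X != pone N, ppow N X p == pone N,
      pmul X Y == pmul Y (ppow N X a),
      sumn [seq logn p k | k <- orbit_sizes N base S] <= 1,
      [&& 0 < d, pow_mod p a d == 1
        & all (fun j => pow_mod p a j != 1) (iota 1 d.-1)]
    & all (fun b => if pow_mod p b d == 1 then true
                    else no_conj N X (ppow N X b) C [::] (pone N))
          (iota 1 p.-1)].

Lemma logn_prodn p (s : seq nat) : 0 < foldr muln 1 s ->
  logn p (foldr muln 1 s) = sumn [seq logn p k | k <- s].
Proof.
elim: s => [|k s IH] /=; first by rewrite logn1.
by rewrite muln_gt0 => /andP[k0 s0]; rewrite lognM // IH.
Qed.

Lemma pow_mod_order p a d : 1 < p -> 0 < d -> a ^ d = 1 %[mod p] ->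
  (forall j, 0 < j < d -> a ^ j <> 1 %[mod p]) ->
  forall i, a ^ i = 1 %[mod p] -> d %| i.
Proof.
move=> p1 d0 ad aj i; rewrite {1}(divn_eq i d) expnD (mulnC (i %/ d)) expnM.
rewrite -modnMml -modnXm ad modnXm exp1n modnMml mul1n => e.
rewrite /dvdn; case: posnP => // r0.
by case: (aj (i %% d)); rewrite // r0 ltn_mod.
Qed.

Lemma certificate_sound base (S : seq (seq nat)) (H : {group perm})
    p d a X Y n :
  prime p -> 0 < n -> tables N S -> complete N base S ->
  gen_group N S = H :> {set perm} -> certificate base S p d a X Y ->
  let A := primary_part p (homology ([subg H] : finGroupType) n) in
  ((exists k, 1 <= k /\ n = 2 * d * k - 1) -> zmod_iso A 'Z_p) /\
  (~ (exists k, 1 <= k /\ n = 2 * d * k - 1) -> zmod_trivial A).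
Proof.
move=> p_prime n0 ST SC SH; have p1 := prime_gt1 p_prime.
case/and5P=> /(sift_encodes ST)[x xS ex] /(sift_encodes ST)[y yS ey].
rewrite -{}ex -{}ey => x1 /eqP xp /and4P[/eqP xy] pp.
case/and3P=> d0 /eqP ad /allP aj /allP fus.
have {}xp : #[x]%g = p.
  apply: nt_prime_order => //; last by apply: contra x1 => /eqP->; rewrite enc1.
  by apply: (@enc_inj N); rewrite encX xp enc1.
have H_S g : (g \in H) = (g \in gen_group N S) by rewrite SH.
have cardS := card_gen ST SC.
have S_gt0 : 0 < foldr muln 1 (orbit_sizes N base S).
  by rewrite -cardS cardG_gt0.
apply: (@subg_cyclic_sylow _ _ _ _ p_prime n0 x) => //; first by rewrite H_S.
- by rewrite -SH cardS pfactor_dvdn // logn_prodn // -ltnNge.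
- exists y, a; split; first by rewrite H_S.
    apply: (mulgI y); rewrite -conjgC; apply: (@enc_inj N).
    by rewrite !encM encX xy.
  apply: pow_mod_order => // [|j jd].
    by rewrite -pow_modE // ad modn_small.
  rewrite -pow_modE // modn_small //; apply/eqP/aj.
  by rewrite mem_iota; lia.
move=> g b gH xg.
have b0 : b %% p != 0.
  apply/eqP=> b0; move: xg; rewrite -expg_mod_order xp b0 expg0.
  move/eqP; rewrite conjg_eq1; apply/negP.
  by apply: contra x1 => /eqP ->; rewrite enc1.
have /fus : b %% p \in iota 1 p.-1.
  by rewrite mem_iota lt0n b0 add1n prednK ?ltn_mod // prime_gt0.
case: eqP => [e _|_ nc].
  by rewrite -modnXm -pow_modE // e modn_small.
rewrite -encX -(@enc1 N) in nc.
case: (no_conj_sound ST SC _ _ nc (k := g)) => //; first by rewrite -H_S.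
by rewrite mulg1 -[in RHS]xp expg_mod_order -xg -conjgC.
Qed.

(** A prime divisor of the order divides one of the orbit lengths. *)
Lemma coprime_sound base (S : seq (seq nat)) (H : {group perm}) p n :
  prime p -> 0 < n -> tables N S -> complete N base S ->
  gen_group N S = H :> {set perm} ->
  p \notin flatten [seq primes k | k <- orbit_sizes N base S] ->
  zmod_trivial (primary_part p (homology ([subg H] : finGroupType) n)).
Proof.
move=> p_prime n0 ST SC SH pS; apply: subg_coprime => //.
rewrite -SH (card_gen ST SC); have := cardG_gt0 (gen_group N S).
rewrite (card_gen ST SC); elim: (orbit_sizes N base S) pS => [|k s IH] /=.
  by rewrite dvdn1; case: eqP p_prime => [->|].
rewrite mem_cat negb_or mem_primes p_prime /= muln_gt0 => /andP[pk ps].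
case/andP=> k0 s0; rewrite Euclid_dvdM // negb_or IH // andbT.
by rewrite k0 in pk.
Qed.

End Certificate.

Lemma zmod_iso_or_trivial p (A : zmodType) (T : Prop) : prime p ->
  (T -> zmod_iso A 'Z_p) -> (~ T -> zmod_trivial A) ->
  [/\ zmod_trivial A \/ zmod_iso A 'Z_p, zmod_iso A 'Z_p <-> T
    & ~ T -> zmod_trivial A].
Proof.
move=> p_prime iso triv; split=> //.
  by case: (EM T) => [/iso|/triv]; [right | left].
split=> // -[f [g fK gK]]; case: (EM T) => // /triv A0.
have := @GRing.oner_neq0 'Z_p; rewrite -(gK 1%R) (A0 (g 1%R)) GRing.raddf0.
by rewrite eqxx.
Qed.

(** * The Mathieu groups *)

(** The cycles of the three generators of M_12, and below those of M_24. *)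
Definition M12_cycles : seq (seq (seq nat)) :=
  [:: [:: iota 0 11];
      [:: [:: 0; 11]; [:: 1; 10]; [:: 2; 5]; [:: 3; 7]; [:: 4; 8]; [:: 6; 9]];
      [:: [:: 2; 6; 10; 7]; [:: 3; 9; 4; 5]]].

Definition M24_cycles : seq (seq (seq nat)) :=
  [:: [:: iota 0 23];
      [:: [:: 0; 23]; [:: 1; 22]; [:: 2; 11]; [:: 3; 15]; [:: 4; 17]; [:: 5; 9];
          [:: 6; 19]; [:: 7; 13]; [:: 8; 20]; [:: 10; 16]; [:: 12; 21];
          [:: 14; 18]];
      [:: [:: 1; 18; 4; 2; 6]; [:: 5; 21; 20; 10; 7]; [:: 8; 16; 13; 9; 12];
          [:: 11; 19; 22; 14; 17]]].

Definition strong_tables N (cycles : seq (seq (seq nat))) program strong :=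
  let L := slp N (pone N :: [seq pcycs N c | c <- cycles]) program in
  [seq nth (pone N) L i | i <- strong].

(** Strong generators computed from the generators of a group by a program
    generate the same group as soon as the generators are among them. *)
Lemma strong_tablesP N cycles program strong (A : {set 'S_N.+1}) :
  A =i [seq cycs N c | c <- cycles] ->
  all (all (all (leq^~ N))) cycles ->
  all [in strong_tables N cycles program strong]
    [seq pcycs N c | c <- cycles] ->
  tables N (strong_tables N cycles program strong) /\
  gen_group N (strong_tables N cycles program strong) = <<A>>%G.
Proof.
move=> Ac cN gS; set S := strong_tables _ _ _ _ in gS *.
have cE c : c \in cycles -> enc (cycs N c) = pcycs N c.
  by move=> cc; rewrite enc_cycs // (allP cN).
have SA s : s \in S -> encodes <<A>>%G s.
  case/mapP=> i _ ->; set L := slp _ _ _.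
  case: (ltnP i (size L)) => iL; last first.
    by rewrite nth_default //; apply: (encodes1 <<A>>%G).
  apply: (@slp_encodes N <<A>>%G program _ _ _ (mem_nth _ iL)) => t.
  rewrite inE => /orP[/eqP->|/mapP[c cc ->]]; first exact: (encodes1 <<A>>%G).
  by rewrite -cE //; exists (cycs N c) => //; rewrite mem_gen // Ac map_f.
split=> [s /SA[g _ e]|]; first by exists g.
apply/val_inj/eqP; rewrite /= eqEsubset !gen_subG; apply/andP; split.
  apply/subsetP=> g; rewrite inE => /SA[h hA /enc_inj <-] //.
apply/subsetP=> g; rewrite Ac => /mapP[c cc ->]; apply: mem_gen.
by rewrite inE cE // (allP gS) // map_f.
Qed.

(** The first entries of the lists on which the programs operate are the
    identity and the three generators; the strong lists give the positions of
    the strong generators. *)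
Definition M12_program : seq (nat * nat) :=
  [:: (1,3); (0,3); (3,1); (4,1); (4,3); (8,1); (5,6); (7,10); (0,7); (9,10);
      (13,10); (14,7); (11,12); (14,15); (17,16); (18,16); (19,16); (20,10)].

Definition M12_strong : seq nat :=
  [:: 1; 2; 3; 7; 10; 16; 17; 21].

Definition M24_program : seq (nat * nat) :=
  [:: (0,3); (0,1); (4,3); (5,1); (6,1); (8,3); (7,3); (5,10); (9,7); (12,11);
      (13,11); (0,11); (11,15); (14,12); (0,17); (16,17); (17,16); (19,17);
      (18,16); (20,17); (23,16); (24,17); (25,17); (22,17); (27,16); (21,16);
      (28,17); (23,30); (26,29); (0,31); (32,31); (34,32); (33,32); (34,31);
      (36,32); (38,31); (37,32); (40,31); (35,31); (41,32); (39,32); (36,31);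
      (45,31); (42,32); (44,31); (43,32); (46,49); (47,48); (31,50); (50,51);
      (53,31); (54,50); (52,55)].

Definition M24_strong : seq nat :=
  [:: 1; 2; 3; 11; 12; 16; 17; 31; 32; 50; 51; 56].

(** In names such as xM22_11 and gM22_11, x and g are elements of the indicated
    Mathieu group, x has the indicated prime order and g conjugates it to one of
    its powers.  The same pair serves for those larger Mathieu groups in which
    no further powers of x are conjugate to x. *)
Definition xM11_5 :=
  [:: 8; 10; 0; 1; 9; 5; 3; 6; 4; 2; 7; 11].
Definition gM11_5 :=
  [:: 8; 3; 2; 7; 0; 5; 1; 6; 9; 4; 10; 11].

Definition xM22_5 :=
  [:: 17; 20; 10; 1; 16; 12; 6; 19; 13; 9; 11; 8; 15; 2; 3; 4; 5; 18; 7; 0;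
      21; 14; 22; 23].
Definition gM22_5 :=
  [:: 0; 14; 15; 20; 13; 8; 9; 17; 4; 6; 16; 12; 2; 5; 3; 11; 10; 18; 19; 7;
      1; 21; 22; 23].

Definition xM21_5 :=
  [:: 15; 3; 14; 12; 16; 13; 4; 5; 20; 10; 7; 18; 0; 9; 6; 1; 2; 17; 8; 11;
      19; 21; 22; 23].
Definition gM21_5 :=
  [:: 3; 15; 16; 0; 14; 10; 6; 7; 19; 13; 5; 18; 12; 9; 4; 1; 2; 17; 11; 8;
      20; 21; 22; 23].

Definition xM21_7 :=
  [:: 15; 7; 6; 10; 1; 0; 16; 8; 5; 17; 11; 14; 2; 9; 18; 4; 13; 12; 20; 3;
      19; 21; 22; 23].
Definition gM21_7 :=
  [:: 1; 4; 13; 11; 0; 15; 17; 7; 5; 9; 18; 19; 6; 16; 10; 8; 2; 12; 14; 3;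
      20; 21; 22; 23].

Definition xM11_11 :=
  [:: 1; 2; 3; 4; 5; 6; 7; 8; 9; 10; 0; 11].
Definition gM11_11 :=
  [:: 0; 3; 6; 9; 1; 4; 7; 10; 2; 5; 8; 11].

Definition xM22_11 :=
  [:: 14; 15; 13; 16; 10; 18; 19; 11; 17; 1; 8; 12; 3; 5; 4; 2; 0; 7; 6; 20;
      21; 9; 22; 23].
Definition gM22_11 :=
  [:: 0; 5; 9; 17; 7; 18; 1; 11; 14; 15; 3; 16; 4; 2; 10; 19; 12; 8; 20; 13;
      6; 21; 22; 23].

Definition xM24_11 :=
  [:: 16; 11; 14; 1; 17; 7; 9; 8; 15; 3; 2; 5; 22; 13; 12; 0; 6; 10; 20; 23;
      4; 21; 19; 18].
Definition gM24_11 :=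
  [:: 10; 17; 16; 20; 11; 12; 22; 19; 18; 23; 15; 2; 1; 21; 9; 4; 14; 7; 6; 8;
      3; 13; 5; 0].

Definition xM23_23 :=
  [:: 1; 2; 3; 4; 5; 6; 7; 8; 9; 10; 11; 12; 13; 14; 15; 16; 17; 18; 19; 20;
      21; 22; 0; 23].
Definition gM23_23 :=
  [:: 1; 3; 5; 7; 9; 11; 13; 15; 17; 19; 21; 0; 2; 4; 6; 8; 10; 12; 14; 16;
      18; 20; 22; 23].

Definition tables12 : seq (seq nat) :=
  strong_tables 11 M12_cycles M12_program M12_strong.
Definition tables24 : seq (seq nat) :=
  strong_tables 23 M24_cycles M24_program M24_strong.

(** The bases list the points in the order in which the Mathieu groups of
    decreasing degree fix them. *)
Definition base12 := [:: 11; 10; 9; 8; 7].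
Definition base24 := [:: 23; 22; 21; 20; 19; 18; 17].

Lemma complete12 : complete 11 base12 tables12.
Proof. by vm_compute. Qed.

Lemma complete24 : complete 23 base24 tables24.
Proof. by vm_compute. Qed.

Lemma tables12P : tables 11 tables12 /\ gen_group 11 tables12 = M12.
Proof.
apply: strong_tablesP; [|by vm_compute..] => g.
by rewrite !inE -orbA.
Qed.

Lemma tables24P : tables 23 tables24 /\ gen_group 23 tables24 = M24.
Proof.
apply: strong_tablesP; [|by vm_compute..] => g.
by rewrite !inE -orbA.
Qed.

(** The tables S with the points base form a complete stabilizer chain for H. *)
Definition chain_of N base (S : seq (seq nat)) (H : {group 'S_N.+1}) : Prop :=
  [/\ tables N S, complete N base S & gen_group N S = H :> {set 'S_N.+1}].

Lemma chain_of_top N base S (A : {group 'S_N.+1}) :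
  tables N S -> gen_group N S = A -> complete N base S ->
  chain_of base S 'C_A([set i : 'I_N.+1 | N.+1 <= i] | 'P)%G.
Proof. by move=> ST SA SC; split=> //; rewrite SA /= fix_top. Qed.

Lemma chain_of_step N m base S (A : {group 'S_N.+1}) :
  chain_of (m :: base) S 'C_A([set i : 'I_N.+1 | m.+1 <= i] | 'P)%G ->
  chain_of base (fixing m S) 'C_A([set i : 'I_N.+1 | m <= i] | 'P)%G.
Proof.
move=> [ST SC SA]; split; first exact: tables_fixing.
  exact: complete_tail SC.
exact: (fix_step ST SC).
Qed.

Definition tables11 := fixing 11 tables12.
Definition tables23 := fixing 23 tables24.
Definition tables22 := fixing 22 tables23.
Definition tables21 := fixing 21 tables22.

Lemma chain12 :
  chain_of base12 tables12 'C_M12([set i : 'I_12 | 12 <= i] | 'P)%G.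
Proof. by case: tables12P => ST SA; apply: (chain_of_top ST SA complete12). Qed.

Lemma chain11 :
  chain_of (behead base12) tables11 'C_M12([set i : 'I_12 | 11 <= i] | 'P)%G.
Proof. exact: chain_of_step chain12. Qed.

Lemma chain24 :
  chain_of base24 tables24 'C_M24([set i : 'I_24 | 24 <= i] | 'P)%G.
Proof. by case: tables24P => ST SA; apply: (chain_of_top ST SA complete24). Qed.

Lemma chain23 :
  chain_of (behead base24) tables23 'C_M24([set i : 'I_24 | 23 <= i] | 'P)%G.
Proof. exact: chain_of_step chain24. Qed.

Lemma chain22 :
  chain_of (drop 2 base24) tables22 'C_M24([set i : 'I_24 | 22 <= i] | 'P)%G.
Proof. exact: chain_of_step chain23. Qed.

Lemma chain21 :
  chain_of (drop 3 base24) tables21 'C_M24([set i : 'I_24 | 21 <= i] | 'P)%G.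
Proof. exact: chain_of_step chain22. Qed.

(** The triples (m, p, d) such that p >= 5 divides the order of M_m and d is the
    number of powers of an element x of order p, among x ^+ 1, ..., x ^+ (p - 1),
    that are conjugate to x. *)
Definition periods : seq (nat * nat * nat) :=
  [:: (11, 5, 4); (12, 5, 4); (22, 5, 4); (23, 5, 4); (24, 5, 4); (21, 5, 2);
      (21, 7, 3); (22, 7, 3); (23, 7, 3); (24, 7, 3);
      (11, 11, 5); (12, 11, 5); (22, 11, 5); (23, 11, 5); (24, 11, 10);
      (23, 23, 11); (24, 23, 11)].

Lemma torsion_caseE m p n : torsion_case m p n <->
  exists d, (m, p, d) \in periods /\ exists k, 1 <= k /\ n = 2 * d * k - 1.
Proof.
split.
  have row q d s : all (fun m => (m, q, d) \in periods) s ->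
      m \in s -> (m, q, d) \in periods by move/allP; apply.
  by case=> [[-> [[ms e]|[-> e]]]|[-> [ms e]]|[-> [[ms e]|[-> e]]]|[-> [ms e]]];
    [exists 4|exists 2|exists 3|exists 5|exists 10|exists 11]; split=> //;
    apply: row ms.
case=> d []; rewrite !inE; do ![case/orP]; case/eqP=> -> -> -> e.
all: first [ by apply: Or41; split=> //; left | by apply: Or41; split=> //; right
           | by apply: Or42
           | by apply: Or43; split=> //; left | by apply: Or43; split=> //; right
           | by apply: Or44 ].
Qed.

Definition period_statement m p d n : Prop :=
  let A := primary_part p (homology (Mathieu m) n) in
  ((exists k, 1 <= k /\ n = 2 * d * k - 1) -> zmod_iso A 'Z_p) /\
  (~ (exists k, 1 <= k /\ n = 2 * d * k - 1) -> zmod_trivial A).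

Lemma cert11_5 : certificate 11 (behead base12) tables11 5 4 2 xM11_5 gM11_5.
Proof. by vm_compute. Qed.

Lemma cert12_5 : certificate 11 base12 tables12 5 4 2 xM11_5 gM11_5.
Proof. by vm_compute. Qed.

Lemma cert22_5 : certificate 23 (drop 2 base24) tables22 5 4 2 xM22_5 gM22_5.
Proof. by vm_compute. Qed.

Lemma cert23_5 : certificate 23 (behead base24) tables23 5 4 2 xM22_5 gM22_5.
Proof. by vm_compute. Qed.

Lemma cert24_5 : certificate 23 base24 tables24 5 4 2 xM22_5 gM22_5.
Proof. by vm_compute. Qed.

Lemma cert21_5 : certificate 23 (drop 3 base24) tables21 5 2 4 xM21_5 gM21_5.
Proof. by vm_compute. Qed.

Lemma cert21_7 : certificate 23 (drop 3 base24) tables21 7 3 2 xM21_7 gM21_7.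
Proof. by vm_compute. Qed.

Lemma cert22_7 : certificate 23 (drop 2 base24) tables22 7 3 2 xM21_7 gM21_7.
Proof. by vm_compute. Qed.

Lemma cert23_7 : certificate 23 (behead base24) tables23 7 3 2 xM21_7 gM21_7.
Proof. by vm_compute. Qed.

Lemma cert24_7 : certificate 23 base24 tables24 7 3 2 xM21_7 gM21_7.
Proof. by vm_compute. Qed.

Lemma cert11_11 : certificate 11 (behead base12) tables11 11 5 3 xM11_11 gM11_11.
Proof. by vm_compute. Qed.

Lemma cert12_11 : certificate 11 base12 tables12 11 5 3 xM11_11 gM11_11.
Proof. by vm_compute. Qed.

Lemma cert22_11 : certificate 23 (drop 2 base24) tables22 11 5 3 xM22_11 gM22_11.
Proof. by vm_compute. Qed.

Lemma cert23_11 : certificate 23 (behead base24) tables23 11 5 3 xM22_11 gM22_11.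
Proof. by vm_compute. Qed.

Lemma cert24_11 : certificate 23 base24 tables24 11 10 2 xM24_11 gM24_11.
Proof. by vm_compute. Qed.

Lemma cert23_23 : certificate 23 (behead base24) tables23 23 11 2 xM23_23 gM23_23.
Proof. by vm_compute. Qed.

Lemma cert24_23 : certificate 23 base24 tables24 23 11 2 xM23_23 gM23_23.
Proof. by vm_compute. Qed.

Lemma periods_sound m p d n : (m, p, d) \in periods -> 0 < n ->
  period_statement m p d n.
Proof.
have [T11 C11 G11] := chain11; have [T12 C12 G12] := chain12.
have [T21 C21 G21] := chain21; have [T22 C22 G22] := chain22.
have [T23 C23 G23] := chain23; have [T24 C24 G24] := chain24.
move=> + n0; rewrite /period_statement !inE.
do ![case/orP]; case/eqP=> -> -> ->; rewrite /Mathieu.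
- exact: (certificate_sound (p := 5) isT n0 T11 C11 G11 cert11_5).
- exact: (certificate_sound (p := 5) isT n0 T12 C12 G12 cert12_5).
- exact: (certificate_sound (p := 5) isT n0 T22 C22 G22 cert22_5).
- exact: (certificate_sound (p := 5) isT n0 T23 C23 G23 cert23_5).
- exact: (certificate_sound (p := 5) isT n0 T24 C24 G24 cert24_5).
- exact: (certificate_sound (p := 5) isT n0 T21 C21 G21 cert21_5).
- exact: (certificate_sound (p := 7) isT n0 T21 C21 G21 cert21_7).
- exact: (certificate_sound (p := 7) isT n0 T22 C22 G22 cert22_7).
- exact: (certificate_sound (p := 7) isT n0 T23 C23 G23 cert23_7).
- exact: (certificate_sound (p := 7) isT n0 T24 C24 G24 cert24_7).
- exact: (certificate_sound (p := 11) isT n0 T11 C11 G11 cert11_11).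
- exact: (certificate_sound (p := 11) isT n0 T12 C12 G12 cert12_11).
- exact: (certificate_sound (p := 11) isT n0 T22 C22 G22 cert22_11).
- exact: (certificate_sound (p := 11) isT n0 T23 C23 G23 cert23_11).
- exact: (certificate_sound (p := 11) isT n0 T24 C24 G24 cert24_11).
- exact: (certificate_sound (p := 23) isT n0 T23 C23 G23 cert23_23).
- exact: (certificate_sound (p := 23) isT n0 T24 C24 G24 cert24_23).
Qed.

Definition mathieu_degrees := [:: 11; 12; 21; 22; 23; 24].

Definition accounted m q := (q < 5) || has (fun r => r.1 == (m, q)) periods.

Lemma primes11 : all (accounted 11)
  (flatten [seq primes k | k <- orbit_sizes 11 (behead base12) tables11]).
Proof. by vm_compute. Qed.

Lemma primes12 : all (accounted 12)
  (flatten [seq primes k | k <- orbit_sizes 11 base12 tables12]).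
Proof. by vm_compute. Qed.

Lemma primes21 : all (accounted 21)
  (flatten [seq primes k | k <- orbit_sizes 23 (drop 3 base24) tables21]).
Proof. by vm_compute. Qed.

Lemma primes22 : all (accounted 22)
  (flatten [seq primes k | k <- orbit_sizes 23 (drop 2 base24) tables22]).
Proof. by vm_compute. Qed.

Lemma primes23 : all (accounted 23)
  (flatten [seq primes k | k <- orbit_sizes 23 (behead base24) tables23]).
Proof. by vm_compute. Qed.

Lemma primes24 : all (accounted 24)
  (flatten [seq primes k | k <- orbit_sizes 23 base24 tables24]).
Proof. by vm_compute. Qed.

Lemma off_periods m p n : m \in mathieu_degrees -> prime p -> 5 <= p -> 0 < n ->
  ~ (exists d, (m, p, d) \in periods) ->
  zmod_trivial (primary_part p (homology (Mathieu m) n)).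
Proof.
have [T11 C11 G11] := chain11; have [T12 C12 G12] := chain12.
have [T21 C21 G21] := chain21; have [T22 C22 G22] := chain22.
have [T23 C23 G23] := chain23; have [T24 C24 G24] := chain24.
move=> mM p_prime p5 n0 np.
have small s : all (accounted m) s -> p \notin s.
  move=> /allP ps; apply/negP => /ps; rewrite /accounted ltnNge p5 orFb.
  by case/hasP=> -[r d] rd /eqP /= e; apply: np; exists d; rewrite -e.
move: mM small {np}; rewrite /mathieu_degrees !inE.
do ![case/orP]; move/eqP=> -> small; rewrite /Mathieu.
- exact: (coprime_sound p_prime n0 T11 C11 G11 (small _ primes11)).
- exact: (coprime_sound p_prime n0 T12 C12 G12 (small _ primes12)).
- exact: (coprime_sound p_prime n0 T21 C21 G21 (small _ primes21)).
- exact: (coprime_sound p_prime n0 T22 C22 G22 (small _ primes22)).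
- exact: (coprime_sound p_prime n0 T23 C23 G23 (small _ primes23)).
- exact: (coprime_sound p_prime n0 T24 C24 G24 (small _ primes24)).
Qed.

Unset Implicit Arguments.

Theorem mainTheorem2 (m p n : nat)
    (hm : m \in [:: 11; 12; 21; 22; 23; 24])
    (hp : prime p) (hp5 : 5 <= p) (hn : 1 <= n) :
  let H := primary_part p (homology (Mathieu m) n) in
  [/\ zmod_trivial H \/ zmod_iso H 'Z_p,
      zmod_iso H 'Z_p <-> torsion_case m p n
    & ~ torsion_case m p n -> zmod_trivial H].
Proof.
apply: zmod_iso_or_trivial => // [|no].
  by move/torsion_caseE => [d [/periods_sound/(_ hn)[iso _] /iso]].
case: (EM (exists d, (m, p, d) \in periods)) => [[d md]|]; last exact: off_periods.
have [_ triv] := periods_sound md hn; apply: triv => k.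
by apply: no; apply/torsion_caseE; exists d.
Qed.
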